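(* Let $\lambda>-1/2$ and $m\geq 1$. Define monic polynomials $P_k$ by $P_0(\mu)=1$, $P_1(\mu)=\mu-\frac{1}{\alpha_1^2\beta_1^2}$ and, for $k\geq 2$, $$P_k(\mu)=\Big[\mu-\frac{1}{\alpha_k^2}\Big(\frac{1}{\beta_{k-1}^2}+\frac{1}{\beta_k^2}\Big)\Big]P_{k-1}(\mu)-\frac{1}{\alpha_{k-1}^2\alpha_k^2\beta_{k-1}^4}P_{k-2}(\mu),$$ and define $\widetilde P_k$ by the same recurrence with $\alpha,\beta$ replaced by $\widetilde\alpha,\widetilde\beta$. Then $\{P_k\}$ and $\{\widetilde P_k\}$ are orthogonal with respect to measures supported on $\mathbb{R}_+$, and the best Markov constant satisfies $$c_n(\lambda)=\frac{2}{\sqrt{\mu_1}}\ \text{ if } n=2m,\qquad c_n(\lambda)=\frac{2}{\sqrt{\widetilde\mu_1}}\ \text{ if } n=2m-1,$$ where $\mu_1$ and $\widetilde\mu_1$ are the smallest zeros of $P_m$ and $\widetilde P_m$, respectively.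
   Context: $\mathcal{P}_n$ denotes the class of real algebraic polynomials of degree at most $n$; $w_\lambda(t)=(1-t^2)^{\lambda-1/2}$ on $(-1,1)$, $\Vert f\Vert_{w_\lambda}=\big(\int_{-1}^1 w_\lambda f^2\,dt\big)^{1/2}$, and $c_n(\lambda)=\sup\{\Vert p'\Vert_{w_\lambda}/\Vert p\Vert_{w_\lambda}: p\in\mathcal{P}_n,\ p\neq 0\}$. For integers $i\geq 0$ let $h_i>0$ with $h_i^2=\frac{\Gamma(i+2\lambda)}{(i+\lambda)\Gamma(i+1)}$. For $k\geq1$: $\alpha_k=(2k-1+\lambda)h_{2k-1}$, $\beta_k=1/h_{2k}$, $\widetilde\alpha_k=(2k-2+\lambda)h_{2k-2}$, $\widetilde\beta_k=1/h_{2k-1}$ (with $\widetilde\alpha_1^2=\lambda\Gamma(2\lambda)=\Gamma(2\lambda+1)/2$, understood by continuity at $\lambda=0$). *)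

(* Defs.v *)
From HB Require Import structures.
From mathcomp Require Import all_boot all_order all_algebra.
From mathcomp Require Import all_classical all_reals all_analysis.
Set Implicit Arguments. Unset Strict Implicit. Unset Printing Implicit Defensive.
Import Order.TTheory GRing.Theory Num.Theory.
Import numFieldNormedType.Exports.
Local Open Scope classical_set_scope.
Local Open Scope ring_scope.

Section Defs.
Variable R : realType.

Definition Gamma_pos (x : R) : R :=
  Rintegral lebesgue_measure [set t : R | 0 < t]
    (fun t => t `^ (x - 1) * expR (- t)).

(* Gamma on (-1, +oo) \ {0} via Gamma(x) = Gamma(x+1)/x for x <= 0
   (only arguments > -1 are ever used below) *)
Definition Gamma (x : R) : R :=
  if 0 < x then Gamma_pos x else Gamma_pos (x + 1) / x.

Definition hsq (lam : R) (i : nat) : R :=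
  Gamma (i%:R + 2 * lam) / ((i%:R + lam) * Gamma (i%:R + 1)).
Definition h (lam : R) (i : nat) : R := Num.sqrt (hsq lam i).

Definition alpha (lam : R) (k : nat) : R := ((k.*2).-1%:R + lam) * h lam (k.*2).-1.
Definition beta (lam : R) (k : nat) : R := 1 / h lam k.*2.
(* alphat_1 is fixed by alphat_1^2 = Gamma(2 lam + 1)/2 (continuity at lam=0) *)
Definition alphat (lam : R) (k : nat) : R :=
  if k == 1%N then Num.sqrt (Gamma (2 * lam + 1) / 2)
  else ((k.*2 - 2)%N%:R + lam) * h lam (k.*2 - 2).
Definition betat (lam : R) (k : nat) : R := 1 / h lam (k.*2).-1.

Fixpoint Prec (a b : nat -> R) (k : nat) : {poly R} :=
  match k with
  | 0 => 1
  | 1 => 'X - (1 / (a 1%N ^+ 2 * b 1%N ^+ 2))%:P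
  | (k'.+1 as k1).+1 =>
      ('X - (1 / a k1.+1 ^+ 2 * (1 / b k1 ^+ 2 + 1 / b k1.+1 ^+ 2))%:P) * Prec a b k1
      - (1 / (a k1 ^+ 2 * a k1.+1 ^+ 2 * b k1 ^+ 4))%:P * Prec a b k'
  end.

Definition P (lam : R) : nat -> {poly R} := Prec (alpha lam) (beta lam).
Definition Pt (lam : R) : nat -> {poly R} := Prec (alphat lam) (betat lam).

Definition wnorm (lam : R) (f : R -> R) : R :=
  Num.sqrt (Rintegral lebesgue_measure [set t : R | -1 < t < 1]
    (fun t => (1 - t ^+ 2) `^ (lam - 2^-1) * f t ^+ 2)).

Definition markov_const (n : nat) (lam : R) : R :=
  sup [set r : R | exists2 p : {poly R}, ((size p <= n.+1)%N /\ p != 0)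
                   & r = wnorm lam (fun t => (p^`()).[t]) / wnorm lam (fun t => p.[t])].

Definition orthogonal_Rplus (mu : {measure set R -> \bar R}) (Q : nat -> {poly R}) : Prop :=
  [/\ mu [set x : R | x < 0] = 0%E,
      (forall k, mu.-integrable setT (fun x => ((Q k).[x] ^+ 2)%:E)),
      (forall j k, j <> k -> (\int[mu]_x ((Q j).[x] * (Q k).[x])%:E = 0)%E)
    & (forall k, (0 < \int[mu]_x ((Q k).[x] ^+ 2)%:E)%E)].

Definition smallest_root (p : {poly R}) (x : R) : Prop :=
  root p x /\ forall y, root p y -> x <= y.

End Defs.

(* Main.v *)
(* Expanding p in Gegenbauer polynomials turns ||p'||^2 / ||p||^2 into a quotient of quadratic forms
   that splits by the parity of the degree into two vibrating strings with point masses
   [a i = alpha_(i+1)^2] and springs [b i = 1 / beta_(i+1)^2] (resp. with tildes):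
     ||p'||^2 = 4 * sum a_i y_i^2   and   ||p||^2 = sum b_i (y_i - y_(i+1))^2.
   The equation of motion of a string is the recurrence defining [P] (resp. [Pt]) up to a factor
   ([shoot] is its solution), so Picone's identity shows that the extremal quotient of each string
   is 4 / mu_1.  The values for [P] and [Pt] interlace, since partial sums of the masses and the
   springs satisfy a monotonicity, whence the string of the parity of n is the extremal one.

   For the orthogonality, the Jacobi operator of the string defines a functional L on polynomials,
   positive on squares, with 0 <= L(x q^2) <= C L(q^2).  Hence L(x^k (C - x)^l) >= 0, and
   Hausdorff's moment theorem represents L by a measure on [0, C]. *)
Require Import Defs.
From HB Require Import structures.
From mathcomp Require Import all_boot all_order all_algebra.
From mathcomp Require Import all_classical all_reals all_analysis.
From mathcomp Require Import measurable_realfun ring lra.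
Set Implicit Arguments. Unset Strict Implicit. Unset Printing Implicit Defensive.
Import Order.TTheory GRing.Theory Num.Theory.
Import numFieldNormedType.Exports.
Local Open Scope classical_set_scope.
Local Open Scope ring_scope.

(** Of the weighted integral only linearity, positivity at the constant 1 and the Pearson identity
    [wint_pearson] enter the algebra. They determine the norms of all Gegenbauer polynomials up to
    one common factor, which cancels in the Markov quotient; so no Beta integral is evaluated, and
    of Gamma only positivity, the functional equation and the value at 1 are needed. The parity
    splitting comes from C_{n+1}' - C_{n-1}' = 2 (n + lam) C_n: if y_i are the coefficients of p'/2,
    those of p are y_i - y_{i+2}. The obstacle is that both parity classes compete for the supremum.
    For even n the two strings have equally many masses, for odd n one has an extra mass, so two
    comparisons are needed; each carries a displacement of one string to a displacement of another
    with the same energy and at least the same mass form. For the measure, the ratios of springs to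
    adjacent masses must be bounded: this confines the spectrum of the Jacobi operator to a compact
    interval. *)

(** * The fundamental theorem of calculus along exhausting compact intervals *)

Section ImproperFTC.
Variable R : realType.
Let mu := @lebesgue_measure R.
Variables (D : set R) (lo hi : nat -> R) (f F : R -> R).
Hypothesis lohi : forall n, lo n < hi n.
Hypothesis lo_decr : forall m n, (m <= n)%N -> lo n <= lo m.
Hypothesis hi_incr : forall m n, (m <= n)%N -> hi m <= hi n.
Hypothesis bigcup_itv : \bigcup_n `[lo n, hi n]%classic = D.
Hypothesis cf : forall x, D x -> {for x, continuous f}.
Hypothesis dF : forall x, D x -> is_derive x 1 F (f x).

Let subD n : `[lo n, hi n] `<=` D.
Proof. by rewrite -bigcup_itv => x xn; exists n. Qed.

Let mD : measurable D.
Proof. by rewrite -bigcup_itv; apply: bigcupT_measurable => n. Qed.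

Let ndI : nondecreasing_seq (fun n => `[lo n, hi n]%classic).
Proof.
move=> m n mn; rewrite subsetEset => x /=; rewrite !in_itv/= => /andP[a b].
by rewrite (le_trans (lo_decr mn) a) (le_trans b (hi_incr mn)).
Qed.

Let cfn n : {within `[lo n, hi n], continuous f}.
Proof.
by apply: continuous_in_subspaceT => x; rewrite inE => xn; apply/cf/(subD xn).
Qed.

Let mfn n : measurable_fun `[lo n, hi n] f.
Proof. by apply: subspace_continuous_measurable_fun; [exact: measurable_itv|exact: cfn]. Qed.

Lemma measurable_fun_exhaustion : measurable_fun D f.
Proof. by rewrite -bigcup_itv; apply/measurable_fun_bigcup => n; [exact: measurable_itv|exact: mfn]. Qed.

Lemma integral_truncated n :
  (\int[mu]_(x in `[lo n, hi n]) (f x)%:E = (F (hi n))%:E - (F (lo n))%:E)%E.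
Proof.
have dcont x : D x -> {for x, continuous F}.
  move=> Dx; apply: differentiable_continuous; apply/derivable1_diffP.
  by have [] := dF Dx.
apply: continuous_FTC2 => //.
- have sub x : x \in `]lo n, hi n[ -> D x.
    move=> xn; apply: (@subD n); apply: subset_itv_oo_cc; exact: xn.
  split => [x /sub /dF[]//||].
  + by apply: cvg_at_right_filter; apply: dcont; apply: (@subD n); rewrite /= in_itv/= lexx ltW.
  + by apply: cvg_at_left_filter; apply: dcont; apply: (@subD n); rewrite /= in_itv/= lexx ltW.
- move=> x xn; rewrite derive1E.
  by have /dF[_ ->] : D x by apply: (@subD n); apply: subset_itv_oo_cc; exact: xn.
Qed.

(** For nonnegative [f], monotone convergence along the intervals suffices: each truncated integral
    is an increment of [F], hence at most [M + M]. *)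
Lemma integrable_exhaustion (M : R) : (forall x, D x -> 0 <= f x) ->
  (forall x, D x -> `|F x| <= M) -> mu.-integrable D (EFin \o f).
Proof.
move=> f0 FM; apply/integrableP; split.
  by apply/measurable_EFinP; exact: measurable_fun_exhaustion.
apply: (@le_lt_trans _ _ (M + M)%:E); last by rewrite ltry.
have -> : (\int[mu]_(x in D) `|(EFin \o f) x| = \int[mu]_(x in \bigcup_n `[lo n, hi n]%classic) (f x)%:E)%E.
  rewrite bigcup_itv; apply: eq_integral => x; rewrite inE => /f0 fx.
  by rewrite /= ger0_norm.
have := @ge0_nondecreasing_set_cvg_integral _ (measurableTypeR R) R (fun n => `[lo n, hi n]%classic) (EFin \o f) mu ndI.
move=> /(_ (fun _ => measurable_itv _)) cv.
have mE n : measurable_fun `[lo n, hi n] (EFin \o f) by apply/measurable_EFinP; exact: mfn.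
have {}cv := cv mE.
have {}cv := cv (fun n x xn => f0 x (subD xn)).
rewrite -(cvg_lim _ cv)//; apply: lime_le.
  by apply/cvg_ex; eexists; exact: cv.
near=> n; rewrite integral_truncated -EFinB lee_fin.
have a : `|F (hi n)| <= M by apply/FM/(@subD n); rewrite /= in_itv/= lexx ltW.
have b : `|F (lo n)| <= M by apply/FM/(@subD n); rewrite /= in_itv/= lexx ltW.
by move: a b; rewrite !ler_norml => /andP[_ a] /andP[b _]; lra.
Unshelve. all: by end_near. Qed.

(** Dominated convergence with [|f|] as majorant, so [f] may change sign, as it does in integrations
    by parts. *)
Lemma Rintegral_exhaustion (l : R) : mu.-integrable D (EFin \o f) ->
  F (hi n) - F (lo n) @[n --> \oo] --> l -> \int[mu]_(x in D) f x = l.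
Proof.
move=> fi cvl.
have mEf : measurable_fun D (EFin \o f) by exact: measurable_int fi.
have [||||//|_ _ cv] := @dominated_convergence _ _ _ mu D mD
  (fun n => (EFin \o f) \_ `[lo n, hi n]) (EFin \o f) (abse \o (EFin \o f)).
- move=> n; apply/measurable_restrict => //.
  by apply: measurable_funS mEf => // x [].
- exact: mEf.
- apply: aeW => x; rewrite -bigcup_itv => -[n _ xn].
  apply: cvg_near_cst; exists n => // m /= nm.
  rewrite patchE ifT// inE; have := ndI nm.
  by rewrite subsetEset; apply.
- exact: integrable_abse.
- apply: aeW => x n Dx; rewrite patchE; case: ifPn => // _.
  by rewrite (_ : point = 0%E)// abse0 abse_ge0.
have {}cv : (F (hi n) - F (lo n))%:E @[n --> \oo] --> (\int[mu]_(x in D) (f x)%:E)%E.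
  apply: cvg_trans cv; apply: near_eq_cvg; apply: nearW => n /=.
  rewrite -integral_mkcondr setIC.
  rewrite setIidl; last exact: subD.
  by rewrite EFinB -integral_truncated.
have cv' : (F (hi n) - F (lo n))%:E @[n --> \oo] --> l%:E.
  by apply: cvg_EFin => //; apply: nearW.
by rewrite /Rintegral (cvg_unique _ cv cv').
Qed.

End ImproperFTC.

(** * Pointwise derivatives, integrability and exhaustions of intervals *)

Section IntegrableFunctions.
Variable R : realType.
Let mu := @lebesgue_measure R.

Lemma is_derive_continuous_for (f : R -> R) (x l : R) :
  is_derive x 1 f l -> {for x, continuous f}.
Proof.
by move=> [df _]; apply: differentiable_continuous; apply/derivable1_diffP.
Qed.

Section PointwiseDerivatives.
Variables (f g : R -> R) (x a b : R).

Lemma is_derive_congr : is_derive x (1 : R) f a -> a = b -> is_derive x (1 : R) f b.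
Proof. by move=> df <-. Qed.

Lemma is_derive_cst1 : is_derive x (1 : R) (fun=> a) 0.
Proof. exact: is_derive_cst. Qed.

Lemma is_derive_id1 : is_derive x (1 : R) (fun t => t) 1.
Proof. exact: is_derive_id. Qed.

Hypotheses (df : is_derive x (1 : R) f a) (dg : is_derive x (1 : R) g b).

Lemma is_derive_opp1 : is_derive x (1 : R) (fun t => - f t) (- a).
Proof. exact: is_deriveN. Qed.

Lemma is_derive_add1 : is_derive x (1 : R) (fun t => f t + g t) (a + b).
Proof. exact: is_deriveD. Qed.

Lemma is_derive_mul1 : is_derive x (1 : R) (fun t => f t * g t) (f x * b + g x * a).
Proof. exact: is_deriveM. Qed.

Lemma is_derive_inv1 : f x != 0 -> is_derive x (1 : R) (fun t => (f t)^-1) (- (f x) ^- 2 * a).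
Proof. by move=> fx; exact: is_deriveV. Qed.

End PointwiseDerivatives.

Lemma is_derive_comp1 (f g : R -> R) (x a b : R) : is_derive (g x) (1 : R) f a ->
  is_derive x (1 : R) g b -> is_derive x (1 : R) (fun t => f (g t)) (a * b).
Proof. by move=> df dg; exact: (@is_derive1_comp R f g). Qed.

Lemma is_derive_powR1 (f : R -> R) (x a y : R) : is_derive x (1 : R) f a -> 0 < f x ->
  is_derive x (1 : R) (fun t => f t `^ y) (y * f x `^ (y - 1) * a).
Proof.
move=> df fx; have dp := is_derive1_powR y fx.
first [exact (is_derive_comp1 dp df) | exact (is_derive1_comp dp df) | by have := is_derive1_comp dp df].
Qed.

Lemma is_derive_expRN (x : R) : is_derive x (1 : R) (fun t => expR (- t)) (- expR (- x)).
Proof.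
apply: is_derive_congr (is_derive_comp1 (is_derive_expR _) (is_derive_opp1 (is_derive_id1 x))) _.
by rewrite mulrN1.
Qed.

Lemma integrable_EFinZ (D : set R) (f : R -> R) (k : R) : measurable D ->
  mu.-integrable D (EFin \o f) -> mu.-integrable D (EFin \o (fun x => k * f x)).
Proof.
move=> mD fi; rewrite (_ : _ \o _ = (fun x => k%:E * (EFin \o f) x)%E).
  exact: integrableZl.
exact/funext.
Qed.

Lemma integrable_EFinB (D : set R) (f g : R -> R) : measurable D ->
  mu.-integrable D (EFin \o f) -> mu.-integrable D (EFin \o g) ->
  mu.-integrable D (EFin \o (fun x => f x - g x)).
Proof.
move=> mD fi gi; rewrite (_ : _ \o _ = ((EFin \o f) \- (EFin \o g))%E).
  exact: integrableB.
exact/funext.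
Qed.

Lemma Rintegral_gt0 (D : set R) (f : R -> R) (a b c : R) : measurable D ->
  mu.-integrable D (EFin \o f) -> (forall x, D x -> 0 <= f x) -> a < b -> 0 < c ->
  `[a, b] `<=` D -> (forall x, x \in `[a, b] -> c <= f x) ->
  0 < \int[mu]_(x in D) f x.
Proof.
move=> mD fi f0 ab c0 abD fc; rewrite -lte_fin /Rintegral fineK; last first.
  exact: integrable_fin_num.
apply: (@lt_le_trans _ _ (\int[mu]_(x in `[a, b]) (cst c%:E x))%E).
  rewrite integral_cst//= lebesgue_measure_itv/= lte_fin ab -EFinB -EFinM lte_fin.
  by rewrite mulr_gt0// subr_gt0.
apply: (@le_trans _ _ (\int[mu]_(x in `[a, b]) (f x)%:E)%E).
  apply: ge0_le_integral => //=.
  - by move=> x xab; rewrite lee_fin ltW.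
  - apply/measurable_EFinP; apply: (measurable_funS mD abD).
    by apply/measurable_EFinP; exact: measurable_int fi.
apply: ge0_subset_integral => //; first exact: measurable_int fi.
Qed.

(** The shift by 3 makes the step less than half of [b - a], so that already the interval for n = 0
    has distinct endpoints. *)
Lemma exhaust_Ioo (a b : R) : a < b ->
  \bigcup_n `[a + (b - a) / n.+3%:R, b - (b - a) / n.+3%:R]%classic = [set t | a < t < b].
Proof.
move=> ab; have ba : 0 < b - a by rewrite subr_gt0.
apply/seteqP; split => [x [n _]|x /= /andP[ax xb]].
  rewrite /= in_itv/= => /andP[h1 h2].
  have h : 0 < (b - a) / n.+3%:R by rewrite divr_gt0.
  by move: h h1 h2; set e := _ / _ => h h1 h2; apply/andP; split; lra.
set e := Num.min (x - a) (b - x).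
have e0 : 0 < e by rewrite lt_min !subr_gt0 ax.
have [n hn] : exists n : nat, (b - a) / e < n%:R.
  by exists (Num.truncn ((b - a) / e)).+1; exact: truncnS_gt.
exists n => //=; rewrite in_itv/=.
have : (b - a) / n.+3%:R <= e.
  rewrite ler_pdivrMr// -ler_pdivrMl// mulrC (le_trans (ltW hn))// ler_nat.
  by rewrite !leqW.
set d := _ / _; rewrite le_min => /andP[h1 h2]; apply/andP; split; lra.
Qed.

Lemma exhaust_gt0 : \bigcup_n `[n.+2%:R^-1, n.+1%:R]%classic = [set t : R | 0 < t].
Proof.
apply/seteqP; split => [x [n _]|x /= x0].
  by rewrite /= in_itv/= => /andP[h1 h2]; apply: lt_le_trans h1; rewrite invr_gt0.
set e := Num.max x x^-1.
have [n hn] : exists n : nat, e < n%:R.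
  by exists (Num.truncn e).+1; exact: truncnS_gt.
exists n => //=; rewrite in_itv/=; move: hn; rewrite gt_max => /andP[h1 h2].
have n1 : (n%:R : R) <= n.+1%:R by rewrite ler_nat.
have n2 : (n%:R : R) <= n.+2%:R by rewrite ler_nat !leqW.
rewrite (le_trans (ltW h1))// andbT -[leRHS]invrK lef_pV2 ?posrE ?invr_gt0//.
by rewrite (le_trans (ltW h2)).
Qed.

End IntegrableFunctions.

(** * The Gamma integral and its functional equation *)

Section GammaFunction.
Variable R : realType.
Let mu := @lebesgue_measure R.

(** The power [y] of the inequalities 1 + t <= y (1 + t/y) <= y exp(t/y). It controls the Gamma
    integrand at infinity, both for integrability and for the boundary term. *)
Lemma powR1D_le_expR (t y : R) : 0 <= t -> 1 <= y -> (1 + t) `^ y <= y `^ y * expR t.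
Proof.
move=> t0 y1; have y0 : 0 < y by apply: lt_le_trans y1.
have h : 1 + t <= y * expR (t / y).
  apply: (@le_trans _ _ (y * (1 + t / y))); last by rewrite ler_pM2l// expR_ge1Dx.
  by rewrite mulrDr mulr1 mulrCA divff ?mulr1 ?gt_eqF// lerD2r.
apply: (@le_trans _ _ ((y * expR (t / y)) `^ y)).
  by apply: ge0_ler_powR; rewrite ?nnegrE ?mulr_ge0 ?addr_ge0 ?expR_ge0 ?(ltW y0).
rewrite powRM ?expR_ge0 ?(ltW y0)// [X in _ * X]/powR gt_eqF ?expR_gt0// expRK.
by rewrite [y * (t / y)]mulrC divfK// gt_eqF.
Qed.

Let lo n : R := n.+2%:R^-1.
Let hi n : R := n.+1%:R.

Let lohi n : lo n < hi n.
Proof.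
rewrite /lo /hi (@lt_le_trans _ _ 1)//; last by rewrite ler1n.
by rewrite invf_lt1// ltr1n.
Qed.

Let lo_decr m n : (m <= n)%N -> lo n <= lo m.
Proof. by move=> mn; rewrite lef_pV2 ?posrE// ler_nat. Qed.

Let hi_incr m n : (m <= n)%N -> hi m <= hi n.
Proof. by move=> mn; rewrite ler_nat. Qed.

Let is_derive_powR_expR (x t : R) : 0 < t ->
  is_derive t (1 : R) (fun t => t `^ x * expR (- t))
    (x * (t `^ (x - 1) * expR (- t)) - t `^ x * expR (- t)).
Proof.
move=> t0; apply: is_derive_congr.
  by apply: is_derive_mul1 (is_derive_expRN t); exact: (is_derive_powR1 _ (is_derive_id1 t)).
by rewrite /=; ring.
Qed.

Let is_derive_1D (t : R) : is_derive t (1 : R) (fun t => 1 + t) 1.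
Proof. by apply: is_derive_congr (is_derive_add1 (is_derive_cst1 t 1) (is_derive_id1 t)) _; rewrite add0r. Qed.

Let is_derive_quot (t : R) : 0 < t -> is_derive t (1 : R) (fun t => t / (1 + t)) ((1 + t) ^- 2).
Proof.
move=> t0; have t1 : 1 + t != 0 by rewrite gt_eqF// ltr_wpDl.
apply: is_derive_congr (is_derive_mul1 (is_derive_id1 t) (is_derive_inv1 (is_derive_1D t) t1)) _.
by field.
Qed.

(** The derivative serves as majorant of the Gamma integrand: it behaves like t^(x-1) at 0 and like
    t^(-2) at infinity, and its antiderivative stays below [x^-1]. *)
Let dom_deriv (x t : R) : 0 < x -> 0 < t ->
  is_derive t (1 : R) (fun t => (t / (1 + t)) `^ x / x) ((t / (1 + t)) `^ (x - 1) / (1 + t) ^+ 2).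
Proof.
move=> x0 t0; have t1 : 1 + t != 0 by rewrite gt_eqF// ltr_wpDl.
have q0 : 0 < t / (1 + t) by rewrite divr_gt0// ltr_wpDl.
apply: is_derive_congr.
  apply: (is_derive_mul1 _ (is_derive_cst1 t x^-1)).
  exact: (is_derive_powR1 _ (is_derive_quot t0) q0).
by rewrite /=; field; rewrite t1 gt_eqF.
Qed.

Lemma integrable_Gamma (x : R) : 0 < x ->
  mu.-integrable [set t : R | 0 < t] (EFin \o (fun t => t `^ (x - 1) * expR (- t))).
Proof.
move=> x0.
have meas : measurable [set t : R | 0 < t].
  by rewrite -exhaust_gt0; apply: bigcupT_measurable => n; exact: measurable_itv.
have dompos (t : R) : 0 < t -> 0 <= (t / (1 + t)) `^ (x - 1) / (1 + t) ^+ 2.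
  by move=> t0; rewrite divr_ge0// ?powR_ge0// exprn_ge0// addr_ge0// ltW.
have i1 : mu.-integrable [set t : R | 0 < t]
    (EFin \o (fun t => (t / (1 + t)) `^ (x - 1) / (1 + t) ^+ 2)).
  apply: (@integrable_exhaustion R _ lo hi _ (fun t => (t / (1 + t)) `^ x / x) lohi lo_decr hi_incr (exhaust_gt0 R) _ _ x^-1).
  - move=> t /= t0; have t1 : 1 + t != 0 by rewrite gt_eqF// ltr_wpDl.
    have q0 : 0 < t / (1 + t) by rewrite divr_gt0// ltr_wpDl.
    apply: continuousM.
      exact: (is_derive_continuous_for (is_derive_powR1 _ (is_derive_quot t0) q0)).
    apply: continuousV; first by rewrite expf_neq0.
    exact: (is_derive_continuous_for (is_derive_mul1 (is_derive_1D t) (is_derive_1D t))).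
  - by move=> t /= t0; exact: dom_deriv.
  - by move=> t /= t0; exact: dompos.
  - move=> t /= t0; have q0 : 0 < t / (1 + t) by rewrite divr_gt0// ltr_wpDl.
    rewrite ger0_norm ?divr_ge0 ?powR_ge0 ?(ltW x0)//.
    rewrite ler_pdivrMr// mulVf ?gt_eqF//.
    rewrite -[leRHS](powRr0 (t / (1 + t))); apply: ger_powR; last exact: ltW.
    by rewrite q0/= ler_pdivrMr ?mul1r; lra.
(* t^(x-1) is the majorant times (1 + t)^(x+1), and this last factor is at most [C] times exp t. *)
pose C := (x + 1) `^ (x + 1).
have i2 : mu.-integrable [set t : R | 0 < t]
    (EFin \o (fun t => C * ((t / (1 + t)) `^ (x - 1) / (1 + t) ^+ 2))).
  exact: integrable_EFinZ.
apply: (@le_integrable _ _ _ mu _ meas _ _ _ _ i2).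
  apply/measurable_EFinP.
  apply: (@measurable_fun_exhaustion R _ lo hi _ (exhaust_gt0 R)) => t /= t0.
  apply: continuousM; first by apply: is_derive_continuous_for; exact: is_derive1_powR.
  apply: is_derive_continuous_for; exact: is_derive_expRN.
move=> t /= t0; have t1 : 0 < 1 + t by rewrite ltr_wpDl.
have q0 : 0 < t / (1 + t) by rewrite divr_gt0.
rewrite lee_fin !ger0_norm ?mulr_ge0 ?powR_ge0 ?expR_ge0 ?invr_ge0 ?exprn_ge0 ?(ltW t1)//.
have -> : t `^ (x - 1) = (t / (1 + t)) `^ (x - 1) / (1 + t) ^+ 2 * (1 + t) `^ (x + 1).
  have -> : (1 + t) `^ (x + 1) = (1 + t) `^ (x - 1) * (1 + t) ^+ 2.
    rewrite -powR_mulrn ?(ltW t1)// -powRD ?(gt_eqF t1) ?implybT//.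
    by congr (_ `^ _); ring.
  have -> : t `^ (x - 1) = (t / (1 + t)) `^ (x - 1) * (1 + t) `^ (x - 1).
    by rewrite -powRM ?(ltW q0) ?(ltW t1)// divfK// gt_eqF.
  by field; rewrite gt_eqF.
rewrite -mulrA mulrC ler_wpM2r ?dompos//.
have := powR1D_le_expR (ltW t0) (_ : 1 <= x + 1).
rewrite lerDr ltW// => /(_ isT) h.
rewrite expRN ler_pdivrMr ?expR_gt0//.
Qed.

Let Gamma_int0 (x : R) : 0 < x ->
  (hi n `^ x * expR (- hi n)) - (lo n `^ x * expR (- lo n)) @[n --> \oo] --> 0.
Proof.
move=> x0; rewrite -[X in _ --> X](subr0 0).
have h0 : (n.+1%:R^-1 : R) @[n --> \oo] --> 0 by exact: cvg_harmonic.
apply: cvgB.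
  (* Using the exponent x + 1 instead of x leaves a factor 1 / (n + 1) to spare. *)
  pose C := (x + 1) `^ (x + 1).
  apply: (@squeeze_cvgr _ _ _ _ (cst 0) (fun n => C * n.+1%:R^-1)); last 2 first.
  - exact: cvg_cst.
  - by rewrite -[X in _ --> X](mulr0 C); apply: cvgMr.
  near=> n; rewrite mulr_ge0 ?powR_ge0 ?expR_ge0//=.
  have hp : 0 < hi n by rewrite /hi ltr0n.
  have := powR1D_le_expR (ltW hp) (_ : 1 <= x + 1).
  rewrite lerDr ltW// => /(_ isT) h.
  rewrite expRN ler_pdivrMr ?expR_gt0// -/(hi n) mulrAC ler_pdivlMr//.
  apply: le_trans h; rewrite powRD; last by rewrite gt_eqF ?implybT// ltr_wpDl// ltW.
  have -> : (1 + hi n) `^ 1 = 1 + hi n by rewrite powRr1// addr_ge0// ltW.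
  have hp1 : hi n <= 1 + hi n by rewrite lerDr.
  apply: ler_pM; rewrite ?powR_ge0 ?(ltW hp)//.
  by apply: ge0_ler_powR; rewrite ?nnegrE ?addr_ge0 ?(ltW x0) ?(ltW hp).
apply: (@squeeze_cvgr _ _ _ _ (cst 0) (fun n => lo n `^ x)); last 2 first.
- exact: cvg_cst.
- have := @powR_cvg0 _ _ x0 => /cvg_at_rightP; apply; split => [n|].
    by rewrite /lo invr_gt0.
  by have := h0; rewrite -(cvg_shiftn 1); under eq_fun do rewrite addn1.
near=> n; rewrite mulr_ge0 ?powR_ge0 ?expR_ge0//= ler_piMr ?powR_ge0//.
by rewrite expR_le1 oppr_le0 invr_ge0.
Unshelve. all: by end_near. Qed.

Lemma Gamma_posS (x : R) : 0 < x -> Gamma_pos (x + 1) = x * Gamma_pos x.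
Proof.
move=> x0; have x1 : 0 < x + 1 by rewrite ltr_wpDr.
have meas : measurable [set t : R | 0 < t].
  by rewrite -exhaust_gt0; apply: bigcupT_measurable => n; exact: measurable_itv.
have i0 := integrable_Gamma x0.
have i1 : mu.-integrable [set t : R | 0 < t] (EFin \o (fun t => t `^ x * expR (- t))).
  by have := integrable_Gamma x1; rewrite addrK.
have i0x : mu.-integrable [set t : R | 0 < t] (EFin \o (fun t => x * (t `^ (x - 1) * expR (- t)))).
  exact: integrable_EFinZ.
have ii : mu.-integrable [set t : R | 0 < t] (EFin \o
    (fun t => x * (t `^ (x - 1) * expR (- t)) - t `^ x * expR (- t))).
  exact: integrable_EFinB.
have := @Rintegral_exhaustion R _ lo hi _ (fun t => t `^ x * expR (- t)) lohi lo_decr hi_incr (exhaust_gt0 R) _ _ 0 ii (Gamma_int0 x0).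
move=> /(_ _ _) h; apply/eqP; rewrite eq_sym -subr_eq0; apply/eqP.
rewrite /Gamma_pos addrK -RintegralZl// -RintegralB//; apply: h.
- move=> t /= t0.
  have c1 y : {for t, continuous (fun t => t `^ y * expR (- t))}.
    apply: continuousM; first by apply: is_derive_continuous_for; exact: is_derive1_powR.
    apply: is_derive_continuous_for; exact: is_derive_expRN.
  by apply: continuousB => //; apply: continuousM => //; exact: cvg_cst.
- by move=> t /= t0; exact: is_derive_powR_expR.
Qed.

Lemma Gamma_pos_gt0 (x : R) : 0 < x -> 0 < Gamma_pos x.
Proof.
move=> x0.
apply: (@Rintegral_gt0 R _ _ 1 2 (Num.min 1 (2 `^ (x - 1)) * expR (- 2))).
- by rewrite -exhaust_gt0; apply: bigcupT_measurable => n; exact: measurable_itv.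
- exact: integrable_Gamma.
- by move=> t t0; rewrite mulr_ge0 ?powR_ge0 ?expR_ge0.
- by lra.
- by rewrite mulr_gt0 ?expR_gt0// lt_min ltr01 powR_gt0.
- by move=> t /=; rewrite in_itv/= => /andP[t1 _]; rewrite (lt_le_trans _ t1).
move=> t; rewrite in_itv/= => /andP[t1 t2].
apply: ler_pM; rewrite ?expR_ge0 ?le_min ?powR_ge0 ?ler01 ?ler_expR ?lerN2//.
rewrite ge_min; have [x1|x1] := leP 1 x.
  by rewrite -[X in X <= _](powRr0 t) ler_powR// subr_ge0.
apply/orP; right; rewrite -[x - 1]opprB !powRN lef_pV2 ?posrE ?powR_gt0//; last lra.
by apply: ge0_ler_powR; rewrite ?nnegrE; lra.
Qed.

Lemma Gamma_pos1 : Gamma_pos (1 : R) = 1.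
Proof.
have meas : measurable [set t : R | 0 < t].
  by rewrite -exhaust_gt0; apply: bigcupT_measurable => n; exact: measurable_itv.
rewrite /Gamma_pos.
have i1 := integrable_Gamma (@ltr01 R).
apply: (@Rintegral_exhaustion R _ lo hi _ (fun t => - expR (- t)) lohi lo_decr hi_incr (exhaust_gt0 R)) => //.
- move=> t /= t0; apply: continuousM; first by apply: is_derive_continuous_for; exact: is_derive1_powR.
  apply: is_derive_continuous_for; exact: is_derive_expRN.
- move=> t /= t0; apply: is_derive_congr (is_derive_opp1 (is_derive_expRN t)) _.
  by rewrite subrr powRr0 opprK mul1r.
have h0 : (n.+1%:R^-1 : R) @[n --> \oo] --> 0 by exact: cvg_harmonic.
have -> : (1 : R) = - 0 - - expR (- 0) by rewrite !oppr0 expR0 opprK add0r.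
apply: cvgB; apply: cvgN.
  apply: (@squeeze_cvgr _ _ _ _ (cst 0) (fun n => n.+1%:R^-1)) => //; last exact: cvg_cst.
  near=> n; rewrite expR_ge0/= expRN lef_pV2 ?posrE ?expR_gt0//.
  by rewrite (le_trans _ (expR_ge1Dx _))// lerDr.
apply: continuous_cvg; first exact: continuous_expR.
by apply: cvgN; have := h0; rewrite -(cvg_shiftn 1); under eq_fun do rewrite addn1.
Unshelve. all: by end_near. Qed.

End GammaFunction.

(** * The Gegenbauer weight and its Pearson identity *)

Section GegenbauerWeight.
Variable R : realType.
Let mu := @lebesgue_measure R.

Lemma horner_norm_le (p : {poly R}) (t : R) : `|t| <= 1 ->
  `|p.[t]| <= \sum_(i < size p) `|p`_i|.
Proof.
move=> t1; rewrite horner_coef (le_trans (ler_norm_sum _ _ _))//.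
by apply: ler_sum => i _; rewrite normrM normrX ler_piMr// exprn_ile1.
Qed.

Variable lam : R.
Hypothesis hlam : - 2^-1 < lam.

Let I1 : set R := [set t | -1 < t < 1].
Let w (t : R) := (1 - t ^+ 2) `^ (lam - 2^-1).
(** With this exponent the weight is (1 - t^2)^(s - 1), and the hypothesis on [lam] is exactly the
    positivity of [s]. *)
Let s := lam + 2^-1.
Let s0 : 0 < s. Proof. by rewrite /s -ltrBlDr sub0r. Qed.
Let sE : lam - 2^-1 = s - 1. Proof. by rewrite /s; lra. Qed.

Let lo n : R := -1 + (1 - -1) / n.+3%:R.
Let hi n : R := 1 - (1 - -1) / n.+3%:R.

Let lohi n : lo n < hi n.
Proof.
have h : (1 - -1) / n.+3%:R < 1 :> R by rewrite ltr_pdivrMr// mul1r (_ : 1 - -1 = 2%:R) ?ltr_nat//; ring.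
by move: h; rewrite /lo /hi; set e := _ / _ => h; lra.
Qed.

Let e_decr m n : (m <= n)%N -> (1 - -1) / n.+3%:R <= (1 - -1) / m.+3%:R :> R.
Proof. by move=> mn; rewrite ler_wpM2l// ?lef_pV2 ?posrE// ?ler_nat//; lra. Qed.

Let lo_decr m n : (m <= n)%N -> lo n <= lo m.
Proof. by move=> /e_decr h; rewrite lerD2l. Qed.

Let hi_incr m n : (m <= n)%N -> hi m <= hi n.
Proof. by move=> /e_decr h; rewrite lerD2l lerN2. Qed.

Let exI : \bigcup_n `[lo n, hi n]%classic = I1.
Proof. by apply: exhaust_Ioo; lra. Qed.

Let mI : measurable I1.
Proof. by rewrite -exI; apply: bigcupT_measurable => n; exact: measurable_itv. Qed.

Let I1_pos t : I1 t -> 0 < 1 - t ^+ 2.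
Proof. by move=> /andP[a b]; nra. Qed.

Let is_derive_1Msqr (t : R) : is_derive t (1 : R) (fun t => 1 - t ^+ 2) (- (2 * t)).
Proof.
apply: is_derive_congr (is_derive_add1 (is_derive_cst1 t 1)
  (is_derive_opp1 (is_derive_mul1 (is_derive_id1 t) (is_derive_id1 t)))) _.
by ring.
Qed.

Let cw t : I1 t -> {for t, continuous w}.
Proof.
move=> It; exact: (is_derive_continuous_for (is_derive_powR1 _ (is_derive_1Msqr t) (I1_pos It))).
Qed.

Let chorner (p : {poly R}) t : {for t, continuous (fun t => p.[t])}.
Proof. exact: (is_derive_continuous_for (is_derive_poly p t)). Qed.

Let w_ge0 t : 0 <= w t. Proof. exact: powR_ge0. Qed.

(** The two endpoint singularities are separated: on either half of the interval one factor of (1 +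
    t)^(s-1) (1 - t)^(s-1) has its base in [1, 2] and is bounded by [C], and the other is a summand
    of [g], whose antiderivative is explicit. *)
Let integrable_w : mu.-integrable I1 (EFin \o w).
Proof.
pose g t : R := (1 + t) `^ (s - 1) + (1 - t) `^ (s - 1).
pose C : R := 2 `^ `|s - 1|.
have d1 (t : R) : is_derive t (1 : R) (fun t => 1 + t) 1.
  by apply: is_derive_congr (is_derive_add1 (is_derive_cst1 t 1) (is_derive_id1 t)) _; rewrite add0r.
have d2 (t : R) : is_derive t (1 : R) (fun t => 1 - t) (- 1).
  apply: is_derive_congr (is_derive_add1 (is_derive_cst1 t 1) (is_derive_opp1 (is_derive_id1 t))) _.
  by rewrite add0r.
have ig : mu.-integrable I1 (EFin \o (fun t => s * g t)).
  apply: (@integrable_exhaustion R _ lo hi _ (fun t => (1 + t) `^ s - (1 - t) `^ s)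
     lohi lo_decr hi_incr exI _ _ (2 `^ s + 2 `^ s)).
  - move=> t /andP[t1 t2]; apply: continuousM; first exact: cvg_cst.
    apply: continuousD.
    + by apply: (is_derive_continuous_for (is_derive_powR1 _ (d1 t) _)); lra.
    + by apply: (is_derive_continuous_for (is_derive_powR1 _ (d2 t) _)); lra.
  - move=> t /andP[t1 t2]; apply: is_derive_congr.
      apply: is_derive_add1; last apply: is_derive_opp1.
        by apply: (is_derive_powR1 _ (d1 t) _); lra.
      by apply: (is_derive_powR1 _ (d2 t) _); lra.
    by rewrite /g/=; ring.
  - by move=> t It; rewrite mulr_ge0 ?(ltW s0)// addr_ge0 ?powR_ge0.
  - move=> t /andP[t1 t2].
    have b u : 0 <= u <= 2 -> 0 <= u `^ s <= 2 `^ s.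
      move=> /andP[u0 u2]; rewrite powR_ge0/=.
      by apply: ge0_ler_powR; rewrite ?nnegrE ?(ltW s0)//; lra.
    have h1 : 0 <= 1 + t <= 2 by apply/andP; split; lra.
    have h2 : 0 <= 1 - t <= 2 by apply/andP; split; lra.
    by have /andP[a1 a2] := b _ h1; have /andP[b1 b2] := b _ h2; rewrite ler_norml; apply/andP; split; lra.
have ig2 := integrable_EFinZ (C / s) mI ig.
apply: (@le_integrable _ _ _ mu _ mI _ _ _ _ ig2).
  apply/measurable_EFinP.
  exact: (@measurable_fun_exhaustion R _ lo hi _ exI cw).
have bnd u : 1 <= u <= 2 -> u `^ (s - 1) <= C.
  move=> /andP[u1 u2]; apply: (@le_trans _ _ (u `^ `|s - 1|)).
    by apply: ler_powR => //; exact: ler_norm.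
  by apply: ge0_ler_powR; rewrite ?nnegrE//; lra.
move=> t It /=; have /andP[t1 t2] := It.
rewrite lee_fin ger0_norm ?w_ge0// ger0_norm; last first.
  by rewrite mulr_ge0// ?divr_ge0 ?powR_ge0 ?(ltW s0)// mulr_ge0 ?(ltW s0)// addr_ge0 ?powR_ge0.
rewrite mulrA divfK ?gt_eqF// /w sE.
have -> : 1 - t ^+ 2 = (1 + t) * (1 - t) by ring.
rewrite powRM; [|lra|lra].
rewrite /g mulrDr; have [t0|t0] := leP 0 t.
  apply: (@le_trans _ _ (C * (1 - t) `^ (s - 1))); last by rewrite lerDr mulr_ge0 ?powR_ge0.
  by rewrite ler_wpM2r ?powR_ge0// bnd//; apply/andP; split; lra.
apply: (@le_trans _ _ (C * (1 + t) `^ (s - 1))); last by rewrite lerDl mulr_ge0 ?powR_ge0.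
by rewrite mulrC ler_wpM2r ?powR_ge0// bnd//; apply/andP; split; lra.
Qed.

Lemma integrable_weight_poly (p : {poly R}) :
  mu.-integrable I1 (EFin \o (fun t => w t * p.[t])).
Proof.
pose C := \sum_(i < size p) `|p`_i|.
have ig := integrable_EFinZ C mI integrable_w.
apply: (@le_integrable _ _ _ mu _ mI _ _ _ _ ig).
  apply/measurable_EFinP; apply: (@measurable_fun_exhaustion R _ lo hi _ exI) => t It.
  by apply: continuousM; [exact: cw|exact: chorner].
move=> t /andP[t1 t2] /=; rewrite lee_fin !normrM mulrC.
apply: ler_pM => //; apply: le_trans (ler_norm _); apply: horner_norm_le.
by rewrite ler_norml; apply/andP; split; lra.
Qed.

Definition wint (p : {poly R}) : R := \int[mu]_(t in I1) (w t * p.[t]).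

Lemma wintD p q : wint (p + q) = wint p + wint q.
Proof.
rewrite /wint -RintegralD//; try exact: integrable_weight_poly.
by apply: eq_Rintegral => t _; rewrite hornerD mulrDr.
Qed.

Lemma wintZ c p : wint (c *: p) = c * wint p.
Proof.
rewrite /wint -RintegralZl//; try exact: integrable_weight_poly.
by apply: eq_Rintegral => t _; rewrite hornerZ mulrCA.
Qed.

Lemma wnorm_wint (p : {poly R}) : wnorm lam (fun t => p.[t]) = Num.sqrt (wint (p ^+ 2)).
Proof.
by rewrite /wnorm /wint; congr Num.sqrt; apply: eq_Rintegral => t _; rewrite horner_exp.
Qed.

Lemma wint1_gt0 : 0 < wint 1.
Proof.
apply: (@Rintegral_gt0 R _ _ (- 2^-1) 2^-1 (Num.min 1 ((4^-1 * 3) `^ (lam - 2^-1)))).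
- exact: mI.
- exact: integrable_weight_poly.
- by move=> t It; rewrite hornerC mulr1.
- by lra.
- by rewrite lt_min ltr01 powR_gt0//; lra.
- by move=> t /=; rewrite in_itv/= => /andP[a b]; apply/andP; split; lra.
move=> t; rewrite in_itv/= => /andP[a b]; rewrite hornerC mulr1 /w.
have u1 : 4^-1 * 3 <= 1 - t ^+ 2 by nra.
have u2 : 1 - t ^+ 2 <= 1 by nra.
rewrite ge_min; have [x1|x1] := leP 0 (lam - 2^-1).
  by apply/orP; right; apply: ge0_ler_powR; rewrite ?nnegrE//; lra.
apply/orP; left; rewrite -[X in X <= _](powRr0 (1 - t ^+ 2)).
by apply: ger_powR; [apply/andP; split; lra|exact: ltW].
Qed.

(** The integrand is the derivative of (1 - t^2)^(lam + 1/2) p(t), which tends to 0 at both ends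
    because the exponent is positive. *)
Lemma wint_pearson (p : {poly R}) :
  wint ((1 - 'X^2) * p^`() - (2 * lam + 1) *: ('X * p)) = 0.
Proof.
pose C := \sum_(i < size p) `|p`_i|.
have C0 : 0 <= C by apply: sumr_ge0.
apply: (@Rintegral_exhaustion R _ lo hi _ (fun t => (1 - t ^+ 2) `^ s * p.[t])
  lohi lo_decr hi_incr exI).
- by move=> t It; apply: continuousM; [exact: cw|exact: chorner].
- move=> t It; have t0 := I1_pos It; apply: is_derive_congr.
    exact: (is_derive_mul1 (is_derive_powR1 _ (is_derive_1Msqr t) t0) (is_derive_poly p t)).
  have -> : (1 - t ^+ 2) `^ s = (1 - t ^+ 2) * w t by rewrite /w sE mulr_powRB1// (ltW t0).
  by rewrite /w sE /s !hornerE/=; field.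
- exact: integrable_weight_poly.
rewrite -[X in _ --> X](subr0 0).
have e0 : ((1 - -1) / n.+3%:R : R) @[n --> \oo] --> 0.
  rewrite -[X in _ --> X](mulr0 (1 - -1)); apply: cvgMr.
  by have := @cvg_harmonic R; rewrite -(cvg_shiftn 2); under eq_fun do rewrite addn2.
have es0 : (((1 - -1) / n.+3%:R : R) `^ s) @[n --> \oo] --> 0.
  have := @powR_cvg0 _ _ s0 => /cvg_at_rightP; apply; split => //.
have bnd t n : 0 < 1 - t ^+ 2 <= 2 * ((1 - -1) / n.+3%:R) -> `|t| <= 1 ->
    `|(1 - t ^+ 2) `^ s * p.[t]| <= 2 `^ s * ((1 - -1) / n.+3%:R) `^ s * C.
  move=> /andP[a b] t1; rewrite normrM ger0_norm ?powR_ge0//.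
  apply: ler_pM; rewrite ?powR_ge0 ?horner_norm_le//.
  have e1 : 0 <= (1 - -1) / n.+3%:R :> R by apply: divr_ge0 => //; lra.
  by rewrite -powRM//; apply: ge0_ler_powR; rewrite ?nnegrE ?mulr_ge0 ?(ltW s0) ?(ltW a).
have key (u : nat -> R) : (forall n, 0 < 1 - u n ^+ 2 <= 2 * ((1 - -1) / n.+3%:R)) ->
    (forall n, `|u n| <= 1) -> (1 - u n ^+ 2) `^ s * p.[u n] @[n --> \oo] --> 0.
  move=> h1 h2; apply/norm_cvg0P.
  apply: (@squeeze_cvgr _ _ _ _ (cst 0) (fun n => 2 `^ s * ((1 - -1) / n.+3%:R) `^ s * C)).
  - by near=> n; rewrite normr_ge0/=; apply: bnd.
  - exact: cvg_cst.
  - rewrite -[X in _ --> X](mul0r C); apply: cvgMl; rewrite -[X in _ --> X](mulr0 (2 `^ s)).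
    exact: cvgMr.
have eb n : 0 < ((1 - -1) / n.+3%:R : R) < 1.
  by apply/andP; split; [rewrite divr_gt0//; lra|rewrite ltr_pdivrMr// mul1r (_ : 1 - -1 = 2%:R) ?ltr_nat//; ring].
apply: cvgB; apply: key => n; have /andP[] := eb n; rewrite /lo /hi; set e := _ / _ => a b.
- by apply/andP; split; nra.
- by rewrite ler_norml; apply/andP; split; lra.
- by apply/andP; split; nra.
- by rewrite ler_norml; apply/andP; split; lra.
Unshelve. all: by end_near. Qed.

End GegenbauerWeight.

(** * Algebraic identities of Gegenbauer polynomials *)

Section GegenbauerPolynomials.
Variable R : realType.
Variable lam : R.
Hypothesis hlam : - 2^-1 < lam.

(* [geg n] is the Gegenbauer polynomial of degree [n.+1], divided by [lam] so that it also makes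
   sense at [lam = 0]; [dgeg n] is [n + lam] times the one of degree [n]. *)
Fixpoint gegpair n : {poly R} * {poly R} :=
  if n is n'.+1 then
    let: (p, q) := gegpair n' in
    (q, n'.+3%:R^-1 *: ((2 * (n'.+2%:R + lam)) *: ('X * q) - (n'.+1%:R + 2 * lam) *: p))
  else (2%:P * 'X, (2 * (1 + lam))%:P * 'X^2 - 1).
Definition geg n := (gegpair n).1.
Definition dgeg n : {poly R} := if n is n'.+1 then (n'.+1%:R + lam) *: geg n' else 1.

Lemma geg0 : geg 0 = 2%:P * 'X. Proof. by []. Qed.
Lemma geg1 : geg 1 = (2 * (1 + lam))%:P * 'X^2 - 1. Proof. by []. Qed.

Lemma gegSS n : n.+3%:R%:P * geg n.+2 =
  (2 * (n.+2%:R + lam))%:P * ('X * geg n.+1) - (n.+1%:R + 2 * lam)%:P * geg n.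
Proof.
rewrite /geg /=; case: (gegpair n) => p q /=.
by rewrite !mul_polyC scalerA divff ?scale1r// pnatr_eq0.
Qed.

Let twolam : -1 < 2 * lam.
Proof. by rewrite (_ : -1 = 2 * - 2^-1) ?ltr_pM2l//; field. Qed.

Let nat1E n : n.+1%:R = n%:R + 1 :> R. Proof. by rewrite -addn1 natrD. Qed.
Let nat2E n : n.+2%:R = n%:R + 2 :> R. Proof. by rewrite -addn2 natrD. Qed.
Let nat3E n : n.+3%:R = n%:R + 3 :> R. Proof. by rewrite -addn3 natrD. Qed.

(** Both relations go through the induction together: differentiating the three-term recurrence
    brings in two older derivatives, and the first relation eliminates the older of them. *)
Lemma geg_deriv_rel n :
  'X * (geg n.+1)^`() - (geg n)^`() = n.+2%:R%:P * geg n.+1 /\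
  (geg n.+1)^`() - 'X * (geg n)^`() = (n.+1%:R + 2 * lam)%:P * geg n.
Proof.
elim: n => [|n [ih1 ih2]].
  rewrite geg0 geg1 !poly.derivE !polyCM !polyCD !polyC1 polyCM.
  by split; ring.
have e3 := gegSS n.
have d3 : n.+3%:R%:P * (geg n.+2)^`() =
  (2 * (n.+2%:R + lam))%:P * (geg n.+1 + 'X * (geg n.+1)^`())
  - (n.+1%:R + 2 * lam)%:P * (geg n)^`().
  by move/(congr1 (@deriv R)): e3; rewrite derivB !derivM !derivC derivX !mul0r !add0r mul1r.
have n3 : n.+3%:R%:P != 0 :> {poly R} by rewrite polyC_eq0 pnatr_eq0.
move: e3 d3 ih1 ih2 n3; rewrite (nat1E n) (nat2E n) (nat3E n) !polyCM !polyCD !polyCM.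
set l := lam%:P; set k0 := geg n; set k1 := geg n.+1; set k2 := geg n.+2.
set k0' := k0^`(); set k1' := k1^`(); set k2' := k2^`(); set N := n%:R%:P.
move=> e3 d3 ih1 ih2 n3.
have k0E : k0' = 'X * k1' - (N + 2%:P) * k1.
  by rewrite (_ : (N + 2%:P) * k1 = 'X * k1' - k0'); [ring | rewrite ih1; ring].
have h2 : k2' - 'X * k1' = (N + 2%:P + 2%:P * l) * k1.
  by apply: (mulfI n3); rewrite mulrBr d3 k0E; ring.
split; last by rewrite h2; ring.
have k2E : k2' = 'X * k1' + (N + 2%:P + 2%:P * l) * k1 by rewrite -h2; ring.
have r : k1' - ('X * k0' + (N + 1%:P + 2%:P * l) * k0) = 0 by rewrite -ih2; ring.
rewrite k0E in r; rewrite e3 k2E; apply/eqP; rewrite -subr_eq0; apply/eqP.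
by rewrite -[RHS]oppr0 -r; ring.
Qed.

Lemma geg_structure n : (1 - 'X^2) * (geg n)^`() =
  (n.+1%:R + 2 * lam)%:P * ('X * geg n) - n.+2%:R%:P * geg n.+1.
Proof.
have [e1 e2] := geg_deriv_rel n; rewrite -e1.
have -> : (n.+1%:R + 2 * lam)%:P * ('X * geg n) = 'X * ((geg n.+1)^`() - 'X * (geg n)^`()).
  by rewrite e2; ring.
by ring.
Qed.

(** The Gegenbauer differential equation: [geg_structure] is differentiated and the derivative of
    the next polynomial is eliminated by the second relation of [geg_deriv_rel]. *)
Lemma geg_ode n : (1 - 'X^2) * (geg n)^`()^`() - (2 * lam + 1)%:P * ('X * (geg n)^`()) =
  - (n.+1%:R * (n.+1%:R + 2 * lam))%:P * geg n.
Proof.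
have [_ e2] := geg_deriv_rel n.
have := congr1 (@deriv R) (geg_structure n).
rewrite !poly.derivE.
have -> : (geg n.+1)^`() = 'X * (geg n)^`() + (n.+1%:R + 2 * lam)%:P * geg n by rewrite -e2; ring.
rewrite (nat1E n) (nat2E n) !polyCM !polyCD !polyCM.
set l := lam%:P; set k := geg n; set k' := k^`(); set k2 := k'^`(); set N := n%:R%:P.
move=> h; apply/eqP; rewrite -subr_eq0; apply/eqP.
move/eqP: h; rewrite -subr_eq0 => /eqP h; rewrite -[RHS]h; ring.
Qed.

(** The relations of [geg_deriv_rel] at neighbouring indices share the term X times a derivative,
    which cancels. For n = 0 and n = 1 the polynomial two steps back would be zero or constant, so
    its derivative is 0. *)
Lemma deriv_geg_dgeg n : (geg n)^`() =
  (if n is n'.+2 then (geg n')^`() else 0) + 2%:P * dgeg n.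
Proof.
case: n => [|[|n]].
- by rewrite geg0 !poly.derivE /=; ring.
- by rewrite geg1 !poly.derivE /= geg0 -mul_polyC !polyCM !polyCD; ring.
have [e1 _] := geg_deriv_rel n; have [_ e2] := geg_deriv_rel n.+1.
rewrite [dgeg _]/= -mul_polyC.
have -> : (geg n)^`() = 'X * (geg n.+1)^`() - n.+2%:R%:P * geg n.+1 by rewrite -e1; ring.
have -> : (geg n.+2)^`() = 'X * (geg n.+1)^`() + (n.+2%:R + 2 * lam)%:P * geg n.+1.
  by rewrite -e2; ring.
by rewrite !polyCD polyCM; ring.
Qed.

Lemma geg_size_coef n : (size (geg n) <= n.+2)%N /\ 0 < (geg n)`_n.+1.
Proof.
suff [] : ((size (geg n) <= n.+2)%N /\ 0 < (geg n)`_n.+1) /\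
    ((size (geg n.+1) <= n.+3)%N /\ 0 < (geg n.+1)`_n.+2) by [].
elim: n => [|n [[s0 c0] [s1 c1]]].
  have l0 : 0 < 2 * (1 + lam) by move: twolam; lra.
  rewrite geg0 geg1 !coefB !coefCM !coefX !coefXn coef1 /= !mulr1 subr0 ltr0n; do !split => //.
    by rewrite mul_polyC (leq_trans (size_scale_leq _ _))// size_polyX.
  apply: leq_trans (size_polyD _ _) _; rewrite geq_max size_polyN size_poly1 mul_polyC.
  by rewrite (leq_trans (size_scale_leq _ _))// size_polyXn.
split => //.
have E : geg n.+2 = n.+3%:R^-1 *: ((2 * (n.+2%:R + lam)) *: ('X * geg n.+1) - (n.+1%:R + 2 * lam) *: geg n).
  by rewrite /geg /=; case: (gegpair n).
have l2 : 0 < n.+2%:R + lam.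
  have h : (1 : R) <= n.+2%:R by rewrite ler1n.
  by move: twolam h; lra.
rewrite E; split.
  apply: leq_trans (size_scale_leq _ _) _; apply: leq_trans (size_polyD _ _) _.
  rewrite geq_max size_polyN !(leq_trans (size_scale_leq _ _))//.
    by rewrite (leq_trans s0)// ltnW.
  rewrite mulrC; case: (eqVneq (geg n.+1) 0) => [->|g0]; first by rewrite mul0r size_poly0.
  by rewrite size_mulX.
rewrite coefZ coefB !coefZ coefXM /= (nth_default _ (leqW s0)) mulr0 subr0.
by rewrite mulr_gt0// ?invr_gt0 ?ltr0n// mulr_gt0// mulr_gt0.
Qed.

(** * Orthogonality, norms and expansions for an abstract Pearson functional *)

Section Functional.
Variable L : {poly R} -> R.
Hypothesis LD : forall p q, L (p + q) = L p + L q.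
Hypothesis LZ : forall c p, L (c *: p) = c * L p.
Hypothesis L1 : 0 < L 1.
Hypothesis LP : forall p, L ((1 - 'X^2) * p^`() - (2 * lam + 1) *: ('X * p)) = 0.

Let LCM c p : L (c%:P * p) = c * L p. Proof. by rewrite mul_polyC LZ. Qed.
Let L0 : L 0 = 0. Proof. by rewrite -(scale0r 0) LZ mul0r. Qed.
Let LN p : L (- p) = - L p. Proof. by rewrite -scaleN1r LZ mulN1r. Qed.
Let LB p q : L (p - q) = L p - L q. Proof. by rewrite LD LN. Qed.
Let Lsum n (f : nat -> {poly R}) : L (\sum_(i < n) f i) = \sum_(i < n) L (f i).
Proof. by elim: n => [|n ih]; rewrite ?big_ord0 ?L0// !big_ord_recr/= LD ih. Qed.

(** Green's formula for the Gegenbauer operator: [LP] is applied to [g] times the derivative of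
    [geg n], and [geg_ode] removes the second derivative. *)
Lemma geg_dirichlet n g : L ((1 - 'X^2) * g^`() * (geg n)^`()) =
  n.+1%:R * (n.+1%:R + 2 * lam) * L (g * geg n).
Proof.
have := LP (g * (geg n)^`()); rewrite derivM -mul_polyC.
rewrite (_ : _ - _ = (1 - 'X^2) * g^`() * (geg n)^`() +
  g * ((1 - 'X^2) * (geg n)^`()^`() - (2 * lam + 1)%:P * ('X * (geg n)^`()))); last by ring.
rewrite geg_ode LD => /eqP; rewrite addr_eq0 => /eqP ->.
by rewrite mulrCA mulNr LN opprK LCM.
Qed.

Let n2lam n : 0 < n.+1%:R + 2 * lam.
Proof. by have h : (1 : R) <= n.+1%:R by [rewrite ler1n]; move: twolam h; lra. Qed.

Let n1lam n : 0 < n.+1%:R + lam.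
Proof. by have h : (1 : R) <= n.+1%:R by [rewrite ler1n]; move: twolam h; lra. Qed.

Lemma L_geg n : L (geg n) = 0.
Proof.
have := geg_dirichlet n 1; rewrite -[1 in X in X = _]polyC1 derivC mulr0 mul0r L0 mul1r => /esym /eqP.
by rewrite !mulf_eq0 (gt_eqF (n2lam n)) pnatr_eq0/= => /eqP.
Qed.

(** The left side of [geg_dirichlet] is symmetric in the two polynomials, while the eigenvalues
    differ by (n - m)(n + m + 2 + 2 lam) > 0. *)
Lemma L_gegM m n : (m < n)%N -> L (geg m * geg n) = 0.
Proof.
move=> mn.
have e1 := geg_dirichlet n (geg m); have e2 := geg_dirichlet m (geg n).
have e : (1 - 'X^2) * (geg n)^`() * (geg m)^`() = (1 - 'X^2) * (geg m)^`() * (geg n)^`() by ring.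
rewrite e e1 [geg n * _]mulrC in e2; apply/eqP.
have {e2} : (n.+1%:R * (n.+1%:R + 2 * lam) - m.+1%:R * (m.+1%:R + 2 * lam)) * L (geg m * geg n) = 0.
  by rewrite mulrBl e2 subrr.
move/eqP; rewrite mulf_eq0 => /orP[|//].
have -> : n.+1%:R * (n.+1%:R + 2 * lam) - m.+1%:R * (m.+1%:R + 2 * lam) =
  (n.+1%:R - m.+1%:R) * (n.+1%:R + (m.+1%:R + 2 * lam)) :> R by ring.
rewrite mulf_eq0 gt_eqF ?subr_gt0 ?ltr_nat//=.
by rewrite gt_eqF// addr_gt0.
Qed.

Definition gegnorm n := L (geg n ^+ 2).

(** The three-term recurrence, tested against its newest and against its oldest polynomial, ties two
    consecutive norms to the same mixed moment; eliminating that moment gives [gegnorm_rec]. *)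
Let L_gegXM n : (n.+2%:R * gegnorm n.+1 = 2 * (n.+1%:R + lam) * L ('X * geg n * geg n.+1)) /\
  2 * (n.+2%:R + lam) * L ('X * geg n * geg n.+1) = (n.+1%:R + 2 * lam) * gegnorm n.
Proof.
rewrite /gegnorm; split.
  case: n => [|n].
    have e : 2%:P * geg 1 = (2 * (1 + lam))%:P * ('X * geg 0) - 2%:P.
      by rewrite geg0 geg1 !polyCM; ring.
    rewrite -LCM expr2 [2%:P * _]mulrA e mulrBl LB.
    by rewrite -[_%:P * ('X * geg 0) * geg 1]mulrA !LCM L_geg mulr0 subr0.
  rewrite -LCM expr2 [_%:P * _]mulrA gegSS mulrBl LB.
  rewrite -[_%:P * ('X * geg n.+1) * geg n.+2]mulrA -[_%:P * geg n * geg n.+2]mulrA !LCM.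
  by rewrite [L (geg n * _)]L_gegM// mulr0 subr0.
have e : (2 * (n.+2%:R + lam))%:P * ('X * geg n.+1) =
   n.+3%:R%:P * geg n.+2 + (n.+1%:R + 2 * lam)%:P * geg n by rewrite gegSS; ring.
have -> : 'X * geg n * geg n.+1 = ('X * geg n.+1) * geg n by ring.
rewrite -LCM [_%:P * _]mulrA e mulrDl LD.
rewrite -[_%:P * geg n.+2 * geg n]mulrA -[_%:P * geg n * geg n]mulrA !LCM.
by rewrite [geg n.+2 * _]mulrC [L (geg n * geg n.+2)]L_gegM// mulr0 add0r expr2.
Qed.

Lemma gegnorm_rec n : n.+2%:R * (n.+2%:R + lam) * gegnorm n.+1 =
  (n.+1%:R + lam) * (n.+1%:R + 2 * lam) * gegnorm n.
Proof.
have [e1 e2] := L_gegXM n.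
by rewrite mulrAC e1 -[RHS]mulrA -e2; ring.
Qed.

Lemma gegnorm0 : (1 + lam) * gegnorm 0 = 2 * L 1.
Proof.
have := LP 'X; rewrite derivX mulr1 LB LZ LB -expr2 => h.
rewrite /gegnorm geg0 exprMn -polyC_exp LCM.
by move: h; set u := L 'X^2 => h; lra.
Qed.

Lemma gegnorm_gt0 n : 0 < gegnorm n.
Proof.
elim: n => [|n ih].
  have l0 : 0 < 1 + lam by have := n1lam 0.
  by rewrite -(pmulr_rgt0 _ l0) gegnorm0 mulr_gt0.
have c : 0 < n.+2%:R * (n.+2%:R + lam) by rewrite mulr_gt0.
by rewrite -(pmulr_rgt0 _ c) gegnorm_rec mulr_gt0// mulr_gt0.
Qed.

Lemma L_dgegM m n : (m < n)%N -> L (dgeg m * dgeg n) = 0.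
Proof.
case: n => // n; case: m => [|m] mn /=; first by rewrite mul1r LZ L_geg mulr0.
by rewrite -!mul_polyC -mulrA LCM mulrCA LCM L_gegM ?mulr0.
Qed.

Definition dgegnorm n := L (dgeg n ^+ 2).

Lemma dgegnorm0 : dgegnorm 0 = L 1.
Proof. by rewrite /dgegnorm expr1n. Qed.

Lemma dgegnormS n : dgegnorm n.+1 = (n.+1%:R + lam) ^+ 2 * gegnorm n.
Proof. by rewrite /dgegnorm /= exprZn LZ. Qed.

Lemma L_sqr_sum (f : nat -> {poly R}) (c : nat -> R) n :
  (forall i j, (i < j)%N -> L (f i * f j) = 0) ->
  L ((\sum_(i < n) c i *: f i) ^+ 2) = \sum_(i < n) c i ^+ 2 * L (f i ^+ 2).
Proof.
move=> fo; elim: n => [|n ih]; first by rewrite !big_ord0 expr0n.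
suff h : L ((\sum_(i < n) c i *: f i) * (c n *: f n)) = 0.
  by rewrite !big_ord_recr/= sqrrD mulr2n !LD h !addr0 ih exprZn LZ.
rewrite mulr_suml (Lsum _ (fun i => c i *: f i * (c n *: f n))) big1// => i _.
by rewrite -!mul_polyC -mulrA LCM mulrCA LCM fo ?mulr0.
Qed.

(** The constant is kept apart because [geg] starts in degree 1. *)
Definition gegsum c0 (d : nat -> R) n : {poly R} := c0%:P + \sum_(i < n) d i *: geg i.

Lemma gegsum_sqr c0 d n : L (gegsum c0 d n ^+ 2) = c0 ^+ 2 * L 1 + \sum_(i < n) d i ^+ 2 * gegnorm i.
Proof.
rewrite /gegsum sqrrD !LD (L_sqr_sum _ _ L_gegM) -polyC_exp -[(c0 ^+ 2)%:P]mulr1 LCM.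
suff h : L (c0%:P * \sum_(i < n) d i *: geg i) = 0 by rewrite h !addr0.
rewrite LCM (Lsum _ (fun i => d i *: geg i)) big1 ?mulr0// => i _.
by rewrite LZ L_geg mulr0.
Qed.

(** Summation by parts with [deriv_geg_dgeg]: coefficients of this form make the derivative diagonal
    in the [dgeg i], and the two vanishing end values remove the boundary terms. *)
Lemma gegsum_deriv c0 (y : nat -> R) n : y n = 0 -> y n.+1 = 0 ->
  (gegsum c0 (fun i => y i - y i.+2) n)^`() = 2%:P * \sum_(i < n) y i *: dgeg i.
Proof.
move=> yn yn1; rewrite /gegsum derivD derivC add0r raddf_sum.
(* The derivative of [geg] moved by two places and extended by zero, so that [deriv_geg_dgeg] takes
   one form for all indices. *)
pose E i : {poly R} := if i is i'.+2 then (geg i')^`() else 0.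
have DE i : 2%:P * dgeg i = E i.+2 - E i.
  by rewrite /E [(geg i)^`()]deriv_geg_dgeg; case: i => [|[|i]]; ring.
have H k : \sum_(i < k) (y i - y i.+2) *: E i.+2 + (y k *: E k + y k.+1 *: E k.+1) =
    \sum_(i < k) y i *: (E i.+2 - E i).
  elim: k => [|k ih]; first by rewrite !big_ord0 /E !scaler0 !addr0.
  rewrite !big_ord_recr/= -ih -!mul_polyC !polyCB; ring.
have := H n; rewrite yn yn1 !scale0r !addr0 => h.
rewrite mulr_sumr (eq_bigr (fun i : 'I_n => (y i - y i.+2) *: E i.+2)); last first.
  by move=> i _; exact: derivZ.
by rewrite h; apply: eq_bigr => i _; rewrite -scalerAr DE.
Qed.

Lemma gegsum_deriv_sqr c0 (y : nat -> R) n : y n = 0 -> y n.+1 = 0 ->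
  L ((gegsum c0 (fun i => y i - y i.+2) n)^`() ^+ 2) = 4 * \sum_(i < n) y i ^+ 2 * dgegnorm i.
Proof.
move=> yn yn1; rewrite gegsum_deriv// exprMn -polyC_exp LCM (L_sqr_sum _ _ L_dgegM).
by congr (_ * _); ring.
Qed.

Lemma size_gegsum c0 d n : (size (gegsum c0 d n) <= n.+1)%N.
Proof.
elim: n => [|n ih]; first by rewrite /gegsum big_ord0 addr0 size_polyC leq_b1.
rewrite /gegsum big_ord_recr/= addrA (leq_trans (size_polyD _ _))// geq_max.
rewrite (leq_trans ih)//= (leq_trans (size_scale_leq _ _))//.
by have [] := geg_size_coef n.
Qed.

Lemma gegsum_exists n (p : {poly R}) : (size p <= n.+1)%N -> exists c0 d, p = gegsum c0 d n.
Proof.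
elim: n p => [|n ih] p sp.
  by exists p`_0, (fun=> 0); rewrite /gegsum big_ord0 addr0; exact: size1_polyC.
have [sg cg] := geg_size_coef n.
pose c := p`_n.+1 / (geg n)`_n.+1.
have [|c0 [d pE]] := ih (p - c *: geg n).
  apply/leq_sizeP => j; rewrite leq_eqVlt => /orP[/eqP <-|nj].
    by rewrite coefB coefZ /c divfK ?subrr// gt_eqF.
  rewrite coefB coefZ !nth_default ?mulr0 ?subr0//; first exact: leq_trans sg nj.
  exact: leq_trans sp nj.
exists c0, (fun i => if (i < n)%N then d i else c).
rewrite /gegsum big_ord_recr/= ltnn addrA.
under eq_bigr => i _ do rewrite ltn_ord.
by rewrite -/(gegsum c0 d n) -pE subrK.
Qed.

(** Solved downwards from the two zero end values; thus every expansion has the shape required by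
    [gegsum_deriv]. *)
Lemma double_diff_exists (d : nat -> R) n : exists y : nat -> R,
  [/\ y n = 0, y n.+1 = 0 & forall i, (i < n)%N -> y i - y i.+2 = d i].
Proof.
elim: n d => [|n ih] d; first by exists (fun=> 0).
have [y [yn yn1 yd]] := ih (fun i => d i.+1).
exists (fun i => if i is i'.+1 then y i' else d 0 + y 1); split => // -[_|i].
  by rewrite addrK.
by rewrite ltnS => /yd.
Qed.

Lemma markov_forms n (p : {poly R}) : (size p <= n.+1)%N -> exists c0 (y : nat -> R),
  [/\ y n = 0, y n.+1 = 0,
  L (p ^+ 2) = c0 ^+ 2 * L 1 + \sum_(i < n) gegnorm i * (y i - y i.+2) ^+ 2 &
  L (p^`() ^+ 2) = 4 * \sum_(i < n) dgegnorm i * y i ^+ 2].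
Proof.
move=> sp; have [c0 [d pE]] := gegsum_exists sp; have [y [yn yn1 yd]] := double_diff_exists d n.
have {}pE : p = gegsum c0 (fun i => y i - y i.+2) n.
  by rewrite pE /gegsum; congr (_ + _); apply: eq_bigr => i _; rewrite yd.
exists c0, y; split => //.
  by rewrite pE gegsum_sqr; congr (_ + _); apply: eq_bigr => i _; rewrite mulrC.
by rewrite pE gegsum_deriv_sqr//; congr (_ * _); apply: eq_bigr => i _; rewrite mulrC.
Qed.

Lemma markov_forms_inv n (y : nat -> R) : y n = 0 -> y n.+1 = 0 ->
  exists2 p : {poly R}, (size p <= n.+1)%N &
  L (p ^+ 2) = \sum_(i < n) gegnorm i * (y i - y i.+2) ^+ 2 /\
  L (p^`() ^+ 2) = 4 * \sum_(i < n) dgegnorm i * y i ^+ 2.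
Proof.
move=> yn yn1; exists (gegsum 0 (fun i => y i - y i.+2) n); first exact: size_gegsum.
rewrite gegsum_sqr gegsum_deriv_sqr// expr0n mul0r add0r.
by split; [|congr (_ * _)]; apply: eq_bigr => i _; rewrite mulrC.
Qed.

Lemma L_sqr_eq0 (p : {poly R}) : L (p ^+ 2) = 0 -> p = 0.
Proof.
have [c0 [d pE]] := gegsum_exists (leqnSn (size p)).
rewrite pE gegsum_sqr => h.
have s0 : 0 <= \sum_(i < size p) d i ^+ 2 * gegnorm i.
  by apply: sumr_ge0 => i _; rewrite mulr_ge0 ?sqr_ge0// ltW// gegnorm_gt0.
have c1 : 0 <= c0 ^+ 2 * L 1 by rewrite mulr_ge0 ?sqr_ge0// ltW.
have /eqP : c0 ^+ 2 * L 1 = 0 by apply/eqP; rewrite eq_le c1 andbT -h lerDl.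
rewrite mulf_eq0 (gt_eqF L1) orbF sqrf_eq0 => /eqP c00.
have /eqP : \sum_(i < size p) d i ^+ 2 * gegnorm i = 0.
  by move: h; rewrite c00 expr0n mul0r add0r.
rewrite psumr_eq0; last by move=> i _; rewrite mulr_ge0 ?sqr_ge0// ltW// gegnorm_gt0.
move=> /allP di; rewrite /gegsum c00 polyC0 add0r big1// => i _.
have := di i; rewrite mem_index_enum => /(_ isT) /=.
by rewrite mulf_eq0 (gt_eqF (gegnorm_gt0 i)) orbF sqrf_eq0 => /eqP ->; rewrite scale0r.
Qed.

End Functional.
End GegenbauerPolynomials.

(** * Quadratic forms of a string with point masses *)

Section StringForms.
Variable R : realType.

Definition massform (a : nat -> R) m (y : nat -> R) : R := \sum_(i < m) a i * y i ^+ 2.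
Definition energyform (b : nat -> R) m (y : nat -> R) : R :=
  \sum_(i < m) b i * (y i - y i.+1) ^+ 2.

Lemma poly_smallest_root (p : {poly R}) (x : R) : p != 0 -> root p x ->
  exists2 z, smallest_root p z & z <= x.
Proof.
elim: {p}(size p) {-2}p (leqnn (size p)) x => [|n ih] p sp x p0 px.
  by rewrite leqn0 size_poly_eq0 in sp; rewrite (eqP sp) eqxx in p0.
have [[y /andP[py yx]]|nx] := pselect (exists y, root p y && (y < x)); last first.
  exists x => //; split => // y py; rewrite leNgt; apply/negP => yx.
  by apply: nx; exists y; rewrite py.
have [q pq] := factor_theorem _ _ px.
have q0 : q != 0 by apply: contraNneq p0 => q0; rewrite pq q0 mul0r.
have sq : (size q <= n)%N.
  by move: sp; rewrite pq size_mul ?polyXsubC_eq0// size_XsubC addn2.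
have rq y' : root q y' -> root p y' by move=> qy; rewrite pq rootM qy.
have qy : root q y.
  by move: py; rewrite pq rootM root_XsubC => /orP[//|/eqP yE]; rewrite yE ltxx in yx.
have [z [qz zmin] zy] := ih q sq y q0 qy.
have zx : z <= x := le_trans zy (ltW yx).
exists z => //; split; first exact: rq.
by move=> u; rewrite pq rootM root_XsubC => /orP[/zmin//|/eqP ->].
Qed.

(** * The shooting solution, its smallest roots and Picone's identity *)

Section Sturm.
Variables a b : nat -> R.
Hypotheses (a_gt0 : forall i, 0 < a i) (b_gt0 : forall i, 0 < b i).

(** The string oscillating with squared frequency ['X], its first mass being free on the left and
    displaced by 1. The second component is the partial sum of mass times displacement, so ['X]
    times it is the tension of spring k. *)
Fixpoint shootflux k : {poly R} * {poly R} :=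
  if k is k'.+1 then
    let: (y, s) := shootflux k' in
    let y' := y - (b k')^-1 *: ('X * s) in (y', s + a k *: y')
  else (1, (a 0)%:P).
Definition shoot k := (shootflux k).1.
Definition flux k := (shootflux k).2.

Lemma shoot0 : shoot 0 = 1. Proof. by []. Qed.
Lemma flux0 : flux 0 = (a 0)%:P. Proof. by []. Qed.
Lemma shootS k : shoot k.+1 = shoot k - (b k)^-1 *: ('X * flux k).
Proof. by rewrite /shoot /flux /=; case: (shootflux k). Qed.
Lemma fluxS k : flux k.+1 = flux k + a k.+1 *: shoot k.+1.
Proof. by rewrite /shoot /flux /=; case: (shootflux k). Qed.

Lemma horner_shoot0 x : (shoot 0).[x] = 1.
Proof. by rewrite shoot0 -polyC1 hornerC. Qed.
Lemma horner_flux0 x : (flux 0).[x] = a 0.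
Proof. by rewrite flux0 hornerC. Qed.
Lemma horner_shootS x k : (shoot k.+1).[x] = (shoot k).[x] - (b k)^-1 * (x * (flux k).[x]).
Proof. by rewrite shootS hornerD hornerN hornerZ hornerM hornerX. Qed.
Lemma horner_fluxS x k : (flux k.+1).[x] = (flux k).[x] + a k.+1 * (shoot k.+1).[x].
Proof. by rewrite fluxS hornerD hornerZ. Qed.

Lemma shoot_step (x : R) k :
  b k * ((shoot k).[x] - (shoot k.+1).[x]) = x * (flux k).[x].
Proof. by rewrite horner_shootS; field; rewrite gt_eqF. Qed.

Lemma shoot_stepS (x : R) k : b k.+1 * ((shoot k.+1).[x] - (shoot k.+2).[x]) =
  b k * ((shoot k).[x] - (shoot k.+1).[x]) + x * (a k.+1 * (shoot k.+1).[x]).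
Proof. by rewrite !shoot_step horner_fluxS mulrDr. Qed.

Lemma shoot_recr (x : R) k :
  b k.+1 * (shoot k.+2).[x] =
  (b k.+1 + b k - x * a k.+1) * (shoot k.+1).[x] - b k * (shoot k).[x].
Proof.
have := shoot_step x k.+1; have := shoot_step x k.
by rewrite horner_fluxS => e1 e2; lra.
Qed.

Lemma shoot_ge1 (x : R) k : x <= 0 -> 1 <= (shoot k).[x] /\ 0 <= (flux k).[x].
Proof.
move=> x0; elim: k => [|k [ih1 ih2]].
  by rewrite horner_shoot0 horner_flux0 lexx ltW.
have h : 1 <= (shoot k.+1).[x].
  rewrite (le_trans ih1)// -subr_le0 -(pmulr_rle0 _ (b_gt0 k)) shoot_step.
  by rewrite mulr_le0_ge0.
by split => //; rewrite horner_fluxS addr_ge0// mulr_ge0// ?(ltW (a_gt0 _)) ?(le_trans _ h).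
Qed.

Lemma shoot_at0 k : (shoot k).[0] = 1.
Proof. by elim: k => [|k ih]; rewrite ?horner_shoot0 ?horner_shootS// ih mul0r mulr0 subr0. Qed.

Lemma shoot_neq0 k : shoot k != 0.
Proof.
by apply/eqP => h; have := shoot_at0 k; rewrite h horner0 => /eqP; rewrite eq_sym oner_eq0.
Qed.

Lemma shoot_root_gt0 k y : root (shoot k) y -> 0 < y.
Proof.
move=> /rootP ky; rewrite ltNge; apply/negP => /(shoot_ge1 k)[].
by rewrite ky => h; have := le_lt_trans h ltr01; rewrite ltxx.
Qed.

Lemma shoot_gt0_before k (x y : R) : smallest_root (shoot k) x -> y < x -> 0 < (shoot k).[y].
Proof.
move=> [kx xmin] yx; rewrite ltNge; apply/negP => hy.
have [y0|y0] := leP y 0.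
  by have [h _] := shoot_ge1 k y0; have := le_lt_trans (le_trans h hy) ltr01; rewrite ltxx.
have [|z /andP[z0 zy] kz] := @poly_ivt R (- shoot k) 0 y (ltW y0).
  by rewrite !hornerN shoot_at0 oppr_le0 ler01 oppr_ge0.
have := xmin z; rewrite -rootN kz => /(_ isT) xz.
by have := lt_le_trans yx (le_trans xz zy); rewrite ltxx.
Qed.

(** The smallest roots decrease strictly with the index: at the smallest root of [shoot m.+1] the
    polynomial [shoot m] is still positive, so the recurrence makes [shoot m.+2] negative there,
    while its value at 0 is 1. *)
Lemma shoot_smallest_root m : exists2 x, smallest_root (shoot m.+1) x &
  forall k y, (k <= m)%N -> y <= x -> 0 < (shoot k).[y].
Proof.
elim: m => [|m [x xmin xpos]].
  exists (b 0 / a 0); last by move=> [|//] y _ _; rewrite horner_shoot0.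
  have e y : root (shoot 1) y -> y = b 0 / a 0.
    move=> /rootP ky; have := shoot_step y 0; rewrite ky horner_shoot0 horner_flux0 subr0 mulr1 => ->.
    by rewrite mulfK// gt_eqF.
  split => [|y /e -> //]; apply/rootP; rewrite horner_shootS horner_shoot0 horner_flux0.
  by field; rewrite !gt_eqF.
have [xroot xle] := xmin; have x0 := shoot_root_gt0 xroot.
have neg : (shoot m.+2).[x] < 0.
  rewrite -(pmulr_rlt0 _ (b_gt0 m.+1)) shoot_recr (rootP xroot) mulr0 sub0r oppr_lt0.
  by rewrite mulr_gt0// xpos.
have [|z /andP[z0 zx] kz] := @poly_ivt R (- shoot m.+2) 0 x (ltW x0).
  by rewrite !hornerN shoot_at0 oppr_le0 ler01 oppr_ge0 ltW.
rewrite rootN in kz; have [u umin uz] := poly_smallest_root (shoot_neq0 m.+2) kz.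
have ux : u < x.
  rewrite lt_neqAle (le_trans uz zx) andbT; apply/eqP => e.
  by move: umin => [/rootP]; rewrite e => h; rewrite h ltxx in neg.
exists u => // k y; rewrite leq_eqVlt => /orP[/eqP ->|km] yu.
  exact: shoot_gt0_before xmin (le_lt_trans yu ux).
by apply: xpos => //; exact: le_trans yu (ltW ux).
Qed.

(** Adding one mass increases the right side minus the left side by b_m u v (z_m / u - z_{m+1} /
    v)^2, where u and v are the consecutive values of the shooting solution. The extra term on the
    right is the boundary contribution of the last spring. *)
Lemma picone (x : R) m (z : nat -> R) : (forall k, (k <= m)%N -> 0 < (shoot k).[x]) ->
  x * massform a m.+1 z <=
  energyform b m z + b m * ((shoot m).[x] - (shoot m.+1).[x]) * (z m ^+ 2 / (shoot m).[x]).
Proof.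
elim: m => [|m ih] pos.
  rewrite shoot_step /massform /energyform big_ord_recl !big_ord0 addr0 add0r.
  by rewrite horner_shoot0 horner_flux0 divr1 mulrA.
have pm : 0 < (shoot m).[x] by apply: pos.
have pm1 : 0 < (shoot m.+1).[x] by apply: pos.
have {}ih := ih (fun k km => pos k (leqW km)).
rewrite /massform big_ord_recr mulrDr/= -/(massform a m.+1 z).
rewrite /energyform big_ord_recr/= -/(energyform b m z).
apply: le_trans (lerD ih (lexx _)) _; rewrite -!addrA lerD2l.
rewrite shoot_stepS.
move: pm pm1; set u := (shoot m).[x]; set v := (shoot m.+1).[x] => u0 v0.
rewrite -subr_ge0; set E := (X in 0 <= X).
have -> : E = b m * (u * v * (z m / u - z m.+1 / v) ^+ 2).
  by rewrite /E; field; rewrite !gt_eqF.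
by rewrite mulr_ge0 ?(ltW (b_gt0 m))// mulr_ge0 ?sqr_ge0// mulr_ge0// ltW.
Qed.

Lemma picone_eq (x : R) m :
  x * massform a m.+1 (fun k => (shoot k).[x]) = energyform b m (fun k => (shoot k).[x]) +
  b m * ((shoot m).[x] - (shoot m.+1).[x]) * (shoot m).[x].
Proof.
elim: m => [|m ih].
  rewrite shoot_step /massform /energyform big_ord_recl !big_ord0 addr0 add0r.
  by rewrite !horner_shoot0 horner_flux0; ring.
rewrite /massform big_ord_recr mulrDr/= -/(massform a m.+1 _) ih.
rewrite /energyform [in RHS]big_ord_recr/= -/(energyform b m _).
rewrite shoot_stepS.
by ring.
Qed.

(** At a root of [shoot m.+1] the boundary term of [picone] becomes b_m z_m^2, the energy of the
    last spring when its far end is fixed. *)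
Lemma massform_le_energyform (x : R) m (z : nat -> R) : root (shoot m.+1) x ->
  (forall k, (k <= m)%N -> 0 < (shoot k).[x]) -> z m.+1 = 0 ->
  x * massform a m.+1 z <= energyform b m.+1 z.
Proof.
move=> /rootP xr pos zm; apply: le_trans (picone z pos) _.
rewrite xr subr0 /energyform big_ord_recr/= zm subr0 lerD2l.
have p0 : (shoot m).[x] != 0 by rewrite gt_eqF// pos.
rewrite le_eqVlt; apply/orP; left; apply/eqP; by field.
Qed.

Lemma massform_eq_energyform (x : R) m : root (shoot m.+1) x ->
  x * massform a m.+1 (fun k => (shoot k).[x]) =
  energyform b m.+1 (fun k => (shoot k).[x]).
Proof.
by move=> /rootP xr; rewrite picone_eq /energyform big_ord_recr/= xr !subr0 -mulrA.
Qed.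

(** The product is the inverse of the leading coefficient of [shoot k], so it makes the shooting
    solution monic. Two consecutive indices are treated at once because the recurrence has order
    two. *)
Lemma horner_Prec (al be : nat -> R) (x : R) k :
  (forall i, al i.+1 ^+ 2 = a i) -> (forall i, (be i.+1 ^+ 2)^-1 = b i) ->
  (Prec al be k).[x] = (\prod_(i < k) - (b i / a i)) * (shoot k).[x].
Proof.
move=> alE beE.
suff [] : (Prec al be k).[x] = (\prod_(i < k) - (b i / a i)) * (shoot k).[x] /\
  (Prec al be k.+1).[x] = (\prod_(i < k.+1) - (b i / a i)) * (shoot k.+1).[x] by [].
elim: k => [|k [ih1 ih2]].
  split; first by rewrite /= big_ord0 horner_shoot0 mulr1.
  rewrite big_ord_recl big_ord0 mulr1 horner_shootS horner_shoot0 horner_flux0 /=.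
  by rewrite hornerD hornerN hornerX hornerC div1r invfM beE alE; field; rewrite !gt_eqF.
split => //.
have E : (Prec al be k.+2).[x] = (x - (a k.+1)^-1 * (b k + b k.+1)) * (Prec al be k.+1).[x]
    - (b k ^+ 2 / (a k * a k.+1)) * (Prec al be k).[x].
  have b4 : be k.+1 ^+ 4 = (be k.+1 ^+ 2) ^+ 2 by rewrite -exprM.
  rewrite [Prec al be k.+2]/= -/(Prec al be k.+1) hornerD hornerN !hornerM hornerD hornerN hornerX !hornerC.
  rewrite !div1r !beE !alE; congr (_ - _ * _).
  by rewrite invfM b4 -exprVn beE mulrC.
rewrite E ih1 ih2 !big_ord_recr /=; set p := \prod_(i < k) _.
have := shoot_recr x k; set u := (shoot k).[x]; set v := (shoot k.+1).[x].
set t := (shoot k.+2).[x] => h.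
have -> : t = ((b k.+1 + b k - x * a k.+1) * v - b k * u) / b k.+1.
  by rewrite -h mulrC mulKf// gt_eqF.
by field; rewrite !gt_eqF.
Qed.

End Sturm.

(** * Comparison of two strings *)

Lemma abel_summation (a g : nat -> R) n :
  \sum_(i < n) a i * g i =
  \sum_(i < n) (\sum_(j < i.+1) a j) * (g i - g i.+1) + (\sum_(i < n) a i) * g n.
Proof.
elim: n => [|n ih]; first by rewrite !big_ord0 mul0r addr0.
by rewrite big_ord_recr/= ih [in RHS]big_ord_recr/= [\sum_(i < n.+1) a i]big_ord_recr/=; ring.
Qed.

(* In the variables [d k = z k - z k.+1] the mass form has the nonnegative matrix [S (min k l)] of partial
   sums, so entrywise domination after rescaling [d] suffices. *)
Lemma string_compare (a b a' b' : nat -> R) m (z : nat -> R) :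
  (forall i, 0 < a i) -> (forall i, 0 < b i) -> (forall i, 0 < a' i) -> (forall i, 0 < b' i) ->
  (forall i k, (i <= k < m)%N ->
     (\sum_(j < i.+1) a j) * b' k <= (\sum_(j < i.+1) a' j) * b k) ->
  z m = 0 ->
  exists y : nat -> R, [/\ y m = 0, massform a m z <= massform a' m y &
    energyform b' m y = energyform b m z].
Proof.
move=> a0 b0 a'0 b'0 H zm.
(* Scaling the extension of spring k by [s k] gives spring [b' k] the energy that [b k] had; the
   absolute values taken in [y] leave the energy unchanged. *)
pose s k : R := Num.sqrt (b k / b' k).
have s2 k : s k ^+ 2 = b k / b' k by rewrite sqr_sqrtr// divr_ge0 ?ltW.
have s0 k : 0 <= s k by exact: sqrtr_ge0.
pose d k := z k - z k.+1.
pose y i : R := \sum_(i <= k < m) s k * `|d k|.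
have yS i : (i < m)%N -> y i = s i * `|d i| + y i.+1 by move=> im; rewrite /y big_ltn.
have y0 i : 0 <= y i by apply: sumr_ge0 => k _; rewrite mulr_ge0.
exists y; split.
- by rewrite /y big_geq.
- rewrite /massform (abel_summation a (fun i => z i ^+ 2)) (abel_summation a' (fun i => y i ^+ 2)) zm expr0n mulr0 addr0.
  have -> : y m = 0 by rewrite /y big_geq.
  rewrite expr0n mulr0 addr0; apply: ler_sum => i _.
  pose S := \sum_(j < i.+1) a j; pose S' := \sum_(j < i.+1) a' j.
  rewrite -/S -/S'.
  have S0 : 0 <= S by apply: sumr_ge0 => j _; exact: ltW.
  have S'0 : 0 <= S' by apply: sumr_ge0 => j _; exact: ltW.
  have Hs k : (i <= k < m)%N -> S <= S' * s k ^+ 2.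
    by move=> /H h; rewrite s2 mulrA ler_pdivlMr.
  (* The mixed bound follows from the diagonal bound at whichever of i and k has the smaller
     scale. *)
  have Hss k : (i <= k < m)%N -> S <= S' * s i * s k.
    move=> ik; have hk := Hs k ik.
    have hi : S <= S' * s i ^+ 2 by apply: Hs; rewrite leqnn ltn_ord.
    have [sik|/ltW ski] := leP (s i) (s k).
      by apply: le_trans hi _; rewrite expr2 mulrA ler_wpM2l// mulr_ge0.
    by apply: le_trans hk _; rewrite expr2 mulrA ler_wpM2r// ler_wpM2l.
  have zy j : (i <= j)%N -> (j <= m)%N -> S * `|z j| <= S' * s i * y j.
    move=> ij jm; rewrite /y.
    have -> : z j = \sum_(j <= k < m) d k.
      rewrite (telescope_sumr_eq (fun k => - z k)) ?zm ?oppr0 ?sub0r ?opprK// => k _.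
      by rewrite /d; ring.
    apply: le_trans (ler_wpM2l S0 (ler_norm_sum _ _ _)) _.
    rewrite !mulr_sumr big_nat_cond [leRHS]big_nat_cond; apply: ler_sum => k /andP[/andP[jk km] _].
    rewrite mulrA ler_wpM2r// Hss// km andbT; exact: leq_trans jk.
  have [h1 h2] := (zy i (leqnn _) (ltnW (ltn_ord i)), zy i.+1 (leqnSn _) (ltn_ord i)).
  rewrite !subr_sqr -/(d i).
  have -> : y i - y i.+1 = s i * `|d i| by rewrite yS//; ring.
  apply: (@le_trans _ _ (S * (`|d i| * (`|z i| + `|z i.+1|)))).
    rewrite ler_wpM2l// (le_trans (ler_norm _))// normrM ler_wpM2l//.
    exact: ler_normD.
  rewrite [leLHS](_ : _ = `|d i| * (S * `|z i| + S * `|z i.+1|)); last by ring.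
  rewrite [leRHS](_ : _ = `|d i| * (S' * s i * y i + S' * s i * y i.+1)); last by ring.
  by rewrite ler_wpM2l// lerD.
- rewrite /energyform; apply: eq_bigr => i _; rewrite yS//.
  by rewrite addrK exprMn s2 real_normK ?num_real// /d; field; rewrite gt_eqF.
Qed.

End StringForms.

(** * Masses and springs in terms of Gamma, and the comparison of the two parities *)

Section GammaNorms.
Variable R : realType.
Variable lam : R.
Hypothesis hlam : - 2^-1 < lam.

Let twolam : -1 < 2 * lam.
Proof. by rewrite (_ : -1 = 2 * - 2^-1) ?ltr_pM2l//; field. Qed.

Let n2lam n : 0 < n.+1%:R + 2 * lam.
Proof. by have h : (1 : R) <= n.+1%:R by [rewrite ler1n]; move: twolam h; lra. Qed.

Lemma natrS_lam_gt0 n : 0 < n.+1%:R + lam.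
Proof. by have h : (1 : R) <= n.+1%:R by [rewrite ler1n]; move: twolam h; lra. Qed.

Let GammaE (x : R) : 0 < x -> Gamma x = Gamma_pos x.
Proof. by rewrite /Gamma => ->. Qed.

Let hsqE n : hsq lam n.+1 =
  Gamma_pos (n.+1%:R + 2 * lam) / ((n.+1%:R + lam) * Gamma_pos (n.+1%:R + 1)).
Proof.
have n0 : 0 < n.+1%:R + 1 :> R by rewrite addr_gt0.
by rewrite /hsq (GammaE (n2lam n)) (GammaE n0).
Qed.

Lemma hsq_gt0 n : 0 < hsq lam n.+1.
Proof.
have n0 : 0 < n.+1%:R + 1 :> R by rewrite addr_gt0.
by rewrite hsqE divr_gt0 ?mulr_gt0 ?Gamma_pos_gt0 ?natrS_lam_gt0.
Qed.

Lemma hsqS n : n.+2%:R * (n.+2%:R + lam) * hsq lam n.+2 =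
  (n.+1%:R + lam) * (n.+1%:R + 2 * lam) * hsq lam n.+1.
Proof.
have n0 : 0 < n.+2%:R :> R by rewrite ltr0n.
have e1 : n.+2%:R + 2 * lam = (n.+1%:R + 2 * lam) + 1 by rewrite -[n.+2]addn1 natrD; ring.
have e2 : n.+1%:R + 1 = n.+2%:R :> R by rewrite -[n.+2]addn1 natrD.
have g0 := Gamma_pos_gt0 n0; have l1 := natrS_lam_gt0 n; have l2 := natrS_lam_gt0 n.+1.
rewrite !hsqE e1 e2 (Gamma_posS (n2lam n)) (Gamma_posS n0).
move: l1 l2 n0 g0; set x1 : R := n.+1%:R; set x2 : R := n.+2%:R.
set g := Gamma_pos x2; set g' := Gamma_pos (x1 + 2 * lam) => l1 l2 n0 g0; clear e1 e2; clearbody g g' x1 x2.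
by field; rewrite ?(gt_eqF l1) ?(gt_eqF l2) ?(gt_eqF n0) ?(gt_eqF g0).
Qed.

Lemma hsq1 : (1 + lam) * hsq lam 1 = Gamma (2 * lam + 1).
Proof.
have l0 : 0 < 1 + lam := natrS_lam_gt0 0; have l2 : 0 < 2 * lam + 1 by rewrite addrC; exact: (n2lam 0).
have g2 : Gamma_pos (1 + 1) = 1 :> R by rewrite (Gamma_posS ltr01) Gamma_pos1 mulr1.
rewrite hsqE g2 (GammaE l2) [2 * lam + 1]addrC mulr1 mulrC divfK// gt_eqF//.
Qed.

Lemma hsqSE n : hsq lam n.+2 =
  (n.+1%:R + lam) * (n.+1%:R + 2 * lam) * hsq lam n.+1 / (n.+2%:R * (n.+2%:R + lam)).
Proof.
by rewrite -hsqS mulrAC divff ?mul1r// mulf_neq0 ?pnatr_eq0// gt_eqF// natrS_lam_gt0.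
Qed.

(** Even indices belong to [alphat] and odd ones to [alpha]; index 0 carries the continuity
    convention for the first [alphat]. *)
Definition phi2 n : R :=
  if n is n'.+1 then (n'.+1%:R + lam) ^+ 2 * hsq lam n'.+1 else Gamma (2 * lam + 1) / 2.

Lemma Gamma2lam_gt0 : 0 < Gamma (2 * lam + 1).
Proof. by rewrite -hsq1 mulr_gt0 ?hsq_gt0//; exact: (natrS_lam_gt0 0). Qed.

Lemma phi2_gt0 n : 0 < phi2 n.
Proof.
case: n => [|n] /=; first by rewrite divr_gt0 ?Gamma2lam_gt0.
by rewrite mulr_gt0 ?exprn_gt0 ?hsq_gt0 ?natrS_lam_gt0.
Qed.

(** Product form of Gamma(n + 2 lam + 2) / (2 (2 lam + 1) n!). It is the sum of [phi2 i] over those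
    i <= n that have the parity of n ([sum_phi2_even], [sum_phi2_odd]), so the partial sums of the
    masses of both strings interleave in one sequence. *)
Fixpoint phisum n : R := if n is n'.+1 then phisum n' * (n'.+2%:R + 2 * lam) / n'.+1%:R else phi2 0.

Lemma phisum_gt0 n : 0 < phisum n.
Proof. by elim: n => [|n ih]; [exact: phi2_gt0|rewrite /= divr_gt0// mulr_gt0]. Qed.

Lemma phi2_phisum n : phi2 n.+2 = 2 * (2 * lam + 1) * (n.+2%:R + lam) * phisum n / (n.+1%:R * n.+2%:R).
Proof.
elim: n => [|n ih].
  have l1 : 1 + lam != 0 by rewrite gt_eqF//; exact: (natrS_lam_gt0 0).
  have l2 : 2 + lam != 0 by rewrite gt_eqF//; exact: (natrS_lam_gt0 1).
  by rewrite /= -hsq1 hsqSE; field.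
have l2 := natrS_lam_gt0 n.+1; have l3 := natrS_lam_gt0 n.+2.
have x1 : n.+1%:R != 0 :> R by rewrite pnatr_eq0.
have x2 : n.+2%:R != 0 :> R by rewrite pnatr_eq0.
have x3 : n.+3%:R != 0 :> R by rewrite pnatr_eq0.
have e : phi2 n.+3 = phi2 n.+2 * ((n.+3%:R + lam) * (n.+2%:R + 2 * lam)) / ((n.+2%:R + lam) * n.+3%:R).
  rewrite [phi2 n.+2]/= [phi2 n.+3]/= hsqSE.
  move: l2 l3 x3; set y2 : R := n.+2%:R; set y3 : R := n.+3%:R => l2 l3 x3; clearbody y2 y3.
  by field; rewrite ?x3 ?(gt_eqF l2) ?(gt_eqF l3).
rewrite e ih [phisum n.+1]/=.
move: l2 x1 x2 x3; set y1 : R := n.+1%:R; set y2 : R := n.+2%:R; set y3 : R := n.+3%:R => l2 x1 x2 x3; clearbody y1 y2 y3.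
by field; rewrite ?x1 ?x2 ?x3 ?(gt_eqF l2).
Qed.

Lemma phisumSS n : phisum n.+2 = phisum n + phi2 n.+2.
Proof.
have e k : k.+1%:R = k%:R + 1 :> R by rewrite -addn1 natrD.
have n0 : n.+1%:R != 0 :> R by rewrite pnatr_eq0.
have n1 : n.+1%:R + 1 != 0 :> R by rewrite -e pnatr_eq0.
rewrite phi2_phisum /= (e n.+2) (e n.+1); move: n0 n1; set x : R := n.+1%:R => n0 n1; clearbody x.
by field; rewrite ?n0 ?n1.
Qed.

Lemma phisum1 : phisum 1 = phi2 1.
Proof. by rewrite /= -hsq1 divr1; field. Qed.

Lemma sum_phi2_even n : \sum_(i < n.+1) phi2 i.*2 = phisum n.*2.
Proof.
elim: n => [|n ih]; first by rewrite big_ord_recr big_ord0 /= add0r.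
rewrite (big_ord_recr n.+1) ih; exact: esym (phisumSS _).
Qed.

Lemma sum_phi2_odd n : \sum_(i < n.+1) phi2 i.*2.+1 = phisum n.*2.+1.
Proof.
elim: n => [|n ih]; first by rewrite phisum1 (big_ord_recr 0) big_ord0; exact: add0r.
rewrite (big_ord_recr n.+1) ih; exact: esym (phisumSS _).
Qed.

(* This monotonicity makes the extremal polynomial of degree [n] have the parity of [n]. *)
Lemma phisum_hsq_le j l : (j <= l)%N ->
  phisum j * hsq lam l.+2 <= phisum j.+1 * hsq lam l.+1.
Proof.
move=> jl /=; have p0 := phisum_gt0 j; have h0 := hsq_gt0 l.
rewrite hsqSE; have l1 := natrS_lam_gt0 l; have l2 := natrS_lam_gt0 l.+1; have n2 := n2lam l.
have e k : k.+1%:R = k%:R + 1 :> R by rewrite -addn1 natrD.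
have x1 : 0 < j.+1%:R :> R by rewrite ltr0n.
have x2 : 0 < l.+2%:R :> R by rewrite ltr0n.
have x12 : l.+1%:R <= l.+2%:R :> R by rewrite ler_nat.
have key : (l.+1%:R + 2 * lam) * j.+1%:R <= (j.+2%:R + 2 * lam) * l.+2%:R.
  have jl' : (j%:R : R) <= l%:R by rewrite ler_nat.
  have j0 : (0 : R) <= j%:R by exact: ler0n.
  rewrite (e j.+1) (e l.+1) (e j) (e l) -subr_ge0.
  have -> : (j%:R + 1 + 1 + 2 * lam) * (l%:R + 1 + 1) - (l%:R + 1 + 2 * lam) * (j%:R + 1) =
    (2 * lam + 1) * (l%:R - j%:R) + (2 * j%:R + 3 + 2 * lam) :> R by ring.
  by rewrite addr_ge0 ?mulr_ge0 ?subr_ge0//; move: twolam; lra.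
move: p0 h0 l1 l2 n2 x1 x2 x12 key; set p := phisum j; set q := hsq lam l.+1.
set u1 : R := l.+1%:R; set u2 : R := l.+2%:R; set v1 : R := j.+1%:R; set v2 : R := j.+2%:R.
move=> p0 h0 l1 l2 n2 x1 x2 x12 key; clearbody p q u1 u2 v1 v2.
(* The factor (l + 1 + lam) / (l + 2 + lam) of [hsqSE] is at most 1 and is dropped; [key] is the
   inequality that remains. *)
apply: (@le_trans _ _ (p * ((u1 + 2 * lam) / u2 * q))).
  rewrite ler_pM2l// [leLHS](_ : _ = (u1 + 2 * lam) / u2 * q * ((u1 + lam) / (u2 + lam))); last first.
    by field; rewrite ?(gt_eqF x2) ?(gt_eqF l2).
  rewrite ler_piMr ?ler_pdivrMr ?mul1r ?lerD2r//.
  by rewrite mulr_ge0 ?divr_ge0 ?(ltW h0) ?(ltW n2) ?(ltW x2).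
rewrite [leRHS](_ : _ = p * ((v2 + 2 * lam) / v1 * q)); last by ring.
by rewrite ler_pM2l// ler_pM2r// ler_pdivrMr// mulrAC ler_pdivlMr.
Qed.

Lemma alpha_sqr i : alpha lam i.+1 ^+ 2 = phi2 i.*2.+1.
Proof. by rewrite /alpha doubleS /= exprMn sqr_sqrtr// ltW// hsq_gt0. Qed.

Lemma beta_sqrV i : (beta lam i.+1 ^+ 2)^-1 = hsq lam i.*2.+2.
Proof. by rewrite /beta doubleS div1r exprVn invrK sqr_sqrtr// ltW// hsq_gt0. Qed.

Lemma alphat_sqr i : alphat lam i.+1 ^+ 2 = phi2 i.*2.
Proof.
case: i => [|i]; rewrite /alphat /=; first by rewrite sqr_sqrtr// divr_ge0// ltW// Gamma2lam_gt0.
by rewrite doubleS subn2 /= doubleS /= exprMn sqr_sqrtr// ltW// hsq_gt0.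
Qed.

Lemma betat_sqrV i : (betat lam i.+1 ^+ 2)^-1 = hsq lam i.*2.+1.
Proof. by rewrite /betat doubleS div1r exprVn invrK sqr_sqrtr// ltW// hsq_gt0. Qed.

(** The names refer to the parity of the degree n; the indices have the opposite parity, since the
    derivative of an even polynomial is odd. *)
Definition mass_even i := phi2 i.*2.+1.
Definition spring_even i := hsq lam i.*2.+2.
Definition mass_odd i := phi2 i.*2.
Definition spring_odd i := hsq lam i.*2.+1.

Let me0 i : 0 < mass_even i. Proof. exact: phi2_gt0. Qed.
Let se0 i : 0 < spring_even i. Proof. exact: hsq_gt0. Qed.
Let mo0 i : 0 < mass_odd i. Proof. exact: phi2_gt0. Qed.
Let so0 i : 0 < spring_odd i. Proof. exact: hsq_gt0. Qed.

Lemma odd_le_even x m z : 0 <= x ->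
  (forall y, y m = 0 -> x * massform mass_even m y <= energyform spring_even m y) ->
  z m = 0 -> x * massform mass_odd m z <= energyform spring_odd m z.
Proof.
move=> x0 H zm.
have [||||||y [ym h1 <-]] := @string_compare R mass_odd spring_odd mass_even spring_even m z => //.
  move=> i k /andP[ik _]; rewrite sum_phi2_even sum_phi2_odd.
  by apply: phisum_hsq_le; rewrite leq_double.
by apply: le_trans (H y ym); rewrite ler_wpM2l.
Qed.

(** The odd string has one mass more. Locking its first spring fuses its first two masses, which
    leaves a string ([a'], [b']) with as many masses as the even one, fit for [string_compare]. A
    displacement of the fused string, with its first value repeated ([u]), is admissible for the odd
    string and puts no energy into the locked spring. *)
Lemma even_le_odd x m z : 0 <= x ->
  (forall y, y m.+1 = 0 -> x * massform mass_odd m.+1 y <= energyform spring_odd m.+1 y) ->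
  z m = 0 -> x * massform mass_even m z <= energyform spring_even m z.
Proof.
case: m => [|m] x0 H zm; first by rewrite /massform /energyform !big_ord0 mulr0.
pose a' i := if i is i'.+1 then mass_odd i'.+2 else mass_odd 0 + mass_odd 1.
pose b' i := spring_odd i.+1.
have a'0 i : 0 < a' i by case: i => [|i]; rewrite /a' ?addr_gt0.
have suma' i : \sum_(j < i.+1) a' j = phisum i.*2.+2.
  rewrite -doubleS -sum_phi2_even big_ord_recl [in RHS]big_ord_recl [in RHS]big_ord_recl addrA.
  by congr (_ + _); apply: eq_bigr.
have [||||||y [ym h1 <-]] := @string_compare R mass_even spring_even a' b' m.+1 z => //.
- by move=> i; exact: so0.
- move=> i k /andP[ik _]; rewrite sum_phi2_odd suma'.
  by rewrite /b' /spring_odd doubleS; apply: phisum_hsq_le; rewrite ltnS leq_double.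
pose u i := if i is i'.+1 then y i' else y 0.
have := H u ym; rewrite /massform /energyform.
rewrite big_ord_recl [in leRHS]big_ord_recl /= subrr expr0n mulr0 add0r => h.
apply: le_trans h; rewrite ler_wpM2l//; apply: le_trans h1 _.
rewrite /massform big_ord_recl [in leRHS]big_ord_recl/= addrA -mulrDl.
by rewrite le_eqVlt; apply/orP; left; apply/eqP; congr (_ + _); apply: eq_bigr.
Qed.

End GammaNorms.

(** * The Markov constant as an extremal Rayleigh quotient *)

Section MarkovConstant.
Variable R : realType.
Variable lam : R.
Hypothesis hlam : - 2^-1 < lam.

Let L := wint lam.
Let LD := wintD hlam.
Let LZ := wintZ hlam.
Let L1 := wint1_gt0 hlam.
Let LP := wint_pearson hlam.

Let normratio := L 1 / phi2 lam 0.

Let normratio_gt0 : 0 < normratio.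
Proof. by rewrite divr_gt0// phi2_gt0. Qed.

(** Both sequences obey the same first-order recurrence ([gegnorm_rec] and [hsqS]), so agreement at
    0 suffices. *)
Let gegnormE n : gegnorm lam L n = normratio * hsq lam n.+1.
Proof.
have l0 : 1 + lam != 0 by rewrite gt_eqF//; exact: (natrS_lam_gt0 hlam 0).
elim: n => [|n ih].
  apply: (mulfI l0); rewrite (gegnorm0 LD LZ LP) -/L mulrCA hsq1// /normratio /=.
  by field; rewrite gt_eqF// Gamma2lam_gt0.
have := gegnorm_rec hlam LD LZ LP n; rewrite ih mulrCA -hsqS// => h.
have c : n.+2%:R * (n.+2%:R + lam) != 0.
  by rewrite mulf_neq0 ?pnatr_eq0// gt_eqF// natrS_lam_gt0.
by apply: (mulfI c); rewrite h mulrCA.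
Qed.

Let dgegnormE n : dgegnorm lam L n = normratio * phi2 lam n.
Proof.
case: n => [|n]; first by rewrite dgegnorm0 /normratio divfK// gt_eqF// phi2_gt0.
by rewrite (dgegnormS _ LZ) gegnormE /= mulrCA.
Qed.

(** The hypotheses say that [x] is the attained minimum of energy over mass. The common factor
    [normratio] cancels, and the 2 is the square root of the 4 in [markov_forms]. *)
Lemma markov_const_eq n (x : R) : 0 < x ->
  (forall y : nat -> R, y n = 0 -> y n.+1 = 0 ->
    x * (\sum_(i < n) phi2 lam i * y i ^+ 2) <= \sum_(i < n) hsq lam i.+1 * (y i - y i.+2) ^+ 2) ->
  (exists y : nat -> R, [/\ y n = 0, y n.+1 = 0, 0 < \sum_(i < n) phi2 lam i * y i ^+ 2 &
    x * (\sum_(i < n) phi2 lam i * y i ^+ 2) = \sum_(i < n) hsq lam i.+1 * (y i - y i.+2) ^+ 2]) ->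
  markov_const n lam = 2 / Num.sqrt x.
Proof.
move=> x0 H [y [yn yn1 ypos yeq]].
have sumG (u : nat -> R) : \sum_(i < n) gegnorm lam L i * u i = normratio * \sum_(i < n) hsq lam i.+1 * u i.
  by rewrite mulr_sumr; apply: eq_bigr => i _; rewrite gegnormE mulrA.
have sumD (u : nat -> R) : \sum_(i < n) dgegnorm lam L i * u i = normratio * \sum_(i < n) phi2 lam i * u i.
  by rewrite mulr_sumr; apply: eq_bigr => i _; rewrite dgegnormE mulrA.
have sx : 0 < Num.sqrt x by rewrite sqrtr_gt0.
have E4 : Num.sqrt (4 : R) = 2 by rewrite (_ : 4 = 2 ^+ 2) ?sqrtr_sqr ?ger0_norm//; ring.
rewrite /markov_const; set S := (X in sup X).
have ub : ubound S (2 / Num.sqrt x).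
  move=> _ [p [sp p0] ->]; rewrite !wnorm_wint -/L.
  have [c0 [u [un un1 e1 e2]]] := markov_forms hlam LD LZ LP sp; rewrite -/L in e1 e2.
  have Lp0 : 0 < L (p ^+ 2).
    rewrite lt_neqAle eq_sym; apply/andP; split.
      by apply: contra_neq p0; exact: (L_sqr_eq0 hlam LD LZ L1 LP).
    rewrite e1; apply: addr_ge0.
      by apply: mulr_ge0; [exact: sqr_ge0|exact: ltW L1].
    apply: sumr_ge0 => i _.
    by rewrite mulr_ge0 ?sqr_ge0// gegnormE mulr_ge0 ?(ltW normratio_gt0)// ltW// hsq_gt0.
  rewrite ler_pdivrMr ?sqrtr_gt0// mulrAC ler_pdivlMr//.
  have Lp'0 : 0 <= L (p^`() ^+ 2).
    rewrite e2; apply: mulr_ge0 => //; apply: sumr_ge0 => i _.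
    apply: mulr_ge0; last exact: sqr_ge0.
    by rewrite dgegnormE; apply: mulr_ge0; apply: ltW => //; exact: phi2_gt0.
  rewrite -E4 -!sqrtrM ?ler0n//.
  apply: ler_wsqrtr; rewrite e1 e2 (sumG (fun i => (u i - u i.+2) ^+ 2)) (sumD (fun i => u i ^+ 2)).
  (* The constant coefficient only enlarges the norm of p, so it is estimated by 0. *)
  rewrite -mulrA ler_pM2l// -mulrA -[leLHS]add0r; apply: lerD.
    by apply: mulr_ge0; [exact: sqr_ge0|exact: ltW L1].
  by rewrite ler_pM2l// mulrC H.
have L00 : L 0 = 0 by have := LZ 0 0; rewrite scale0r mul0r.
have mem : S (2 / Num.sqrt x).
  have [p sp [e1 e2]] := markov_forms_inv hlam LD LZ LP yn yn1; rewrite -/L in e1 e2.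
  have {}e1 : L (p ^+ 2) = normratio * (x * \sum_(i < n) phi2 lam i * y i ^+ 2).
    by rewrite e1 (sumG (fun i => (y i - y i.+2) ^+ 2)) yeq.
  have {}e2 : L (p^`() ^+ 2) = 4 * (normratio * \sum_(i < n) phi2 lam i * y i ^+ 2).
    by rewrite e2 (sumD (fun i => y i ^+ 2)).
  set M := normratio * \sum_(i < n) phi2 lam i * y i ^+ 2 in e2.
  have M0 : 0 < M by rewrite mulr_gt0.
  have {}e1 : L (p ^+ 2) = x * M by rewrite e1 /M; ring.
  exists p; first split => //.
    apply/eqP => p0; move: e1; rewrite p0 expr0n /= L00 => /esym/eqP.
    by rewrite gt_eqF// mulr_gt0.
  rewrite !wnorm_wint -/L e1 e2 (sqrtrM _ (ltW x0)) sqrtrM ?ler0n// E4.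
  by rewrite invfM mulrACA divff ?mulr1// gt_eqF// sqrtr_gt0.
apply/eqP; rewrite eq_le; apply/andP; split.
  by apply: ge_sup => //; exists (2 / Num.sqrt x).
by apply: ub_le_sup => //; exists (2 / Num.sqrt x).
Qed.

Lemma sum_double (F : nat -> R) m : \sum_(i < m.*2) F i =
  \sum_(i < m) F i.*2 + \sum_(i < m) F i.*2.+1.
Proof.
elim: m => [|m ih]; first by rewrite !big_ord0 addr0.
by rewrite doubleS !big_ord_recr/= ih; ring.
Qed.

Let ME := mass_even lam.
Let SE := spring_even lam.
Let MO := mass_odd lam.
Let SO := spring_odd lam.
Let me0 i : 0 < ME i. Proof. exact: phi2_gt0. Qed.
Let se0 i : 0 < SE i. Proof. exact: hsq_gt0. Qed.
Let mo0 i : 0 < MO i. Proof. exact: phi2_gt0. Qed.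
Let so0 i : 0 < SO i. Proof. exact: hsq_gt0. Qed.

Lemma smallest_root_Prec (a b al be : nat -> R) k x :
  (forall i, 0 < a i) -> (forall i, 0 < b i) ->
  (forall i, al i.+1 ^+ 2 = a i) -> (forall i, (be i.+1 ^+ 2)^-1 = b i) ->
  smallest_root (shoot a b k) x -> smallest_root (Prec al be k) x.
Proof.
move=> a0 b0 aE bE.
have rE y : root (Prec al be k) y = root (shoot a b k) y.
  rewrite /root (horner_Prec a0 b0 y k aE bE) mulf_eq0 orb_idl// => /eqP h.
  have : \prod_(i < k) - (b i / a i) != 0.
    by apply/prodf_neq0 => i _; rewrite oppr_eq0 mulf_neq0 ?invr_eq0 ?gt_eqF.
  by rewrite h eqxx.
by move=> [xr xmin]; split; [rewrite rE|move=> y; rewrite rE; exact: xmin].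
Qed.

Lemma massform_shoot_gt0 (a b : nat -> R) m x : (forall i, 0 < a i) ->
  (forall k, (k <= m)%N -> 0 < (shoot a b k).[x]) ->
  0 < massform a m.+1 (fun k => (shoot a b k).[x]).
Proof.
move=> a0 pos; rewrite /massform big_ord_recl ltr_pwDl//.
  by rewrite mulr_gt0// exprn_gt0// pos.
by apply: sumr_ge0 => i _; rewrite mulr_ge0 ?sqr_ge0 ?(ltW (a0 _)).
Qed.

Lemma markov_even m : exists mu1 : R, smallest_root (P lam m.+1) mu1 /\
  markov_const m.+1.*2 lam = 2 / Num.sqrt mu1.
Proof.
have [x xmin xpos] := shoot_smallest_root me0 se0 m; exists x; split.
  exact: smallest_root_Prec me0 se0 (alpha_sqr hlam) (beta_sqrV hlam) xmin.
have [xr _] := xmin; have x0 := shoot_root_gt0 me0 se0 xr.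
have pos k : (k <= m)%N -> 0 < (shoot ME SE k).[x] by move=> km; apply: xpos.
have HE z : z m.+1 = 0 -> x * massform ME m.+1 z <= energyform SE m.+1 z.
  exact: massform_le_energyform.
apply: markov_const_eq => //.
  move=> y yn yn1; rewrite (sum_double (fun i => phi2 lam i * y i ^+ 2)).
  rewrite (sum_double (fun i => hsq lam i.+1 * (y i - y i.+2) ^+ 2)) mulrDr; apply: lerD.
    (* The indices of the competing parity get their bound by comparison of the strings. *)
    apply: (odd_le_even hlam (ltW x0) HE (z := fun i => y i.*2)); exact: yn.
  by apply: (HE (fun i => y i.*2.+1)).
(* The extremal displacement lives on the odd indices. It vanishes at n by parity and at n + 1
   because [x] is a root of [shoot m.+1]. *)
exists (fun i => if odd i then (shoot ME SE i./2).[x] else 0); split.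
- by rewrite odd_double.
- by rewrite /= odd_double uphalf_double; exact/rootP.
- rewrite (sum_double (fun i => phi2 lam i * (if odd i then (shoot ME SE i./2).[x] else 0) ^+ 2)).
  rewrite [X in X + _]big1 ?add0r; last by move=> i _; rewrite odd_double expr0n mulr0.
  rewrite (eq_bigr (fun i : 'I_m.+1 => ME i * (shoot ME SE i).[x] ^+ 2)); first exact: massform_shoot_gt0.
  by move=> i _; rewrite /= odd_double uphalf_double.
rewrite (sum_double (fun i => phi2 lam i * (if odd i then (shoot ME SE i./2).[x] else 0) ^+ 2)).
rewrite (sum_double (fun i => hsq lam i.+1 * ((if odd i then (shoot ME SE i./2).[x] else 0) -
   (if odd i.+2 then (shoot ME SE i.+2./2).[x] else 0)) ^+ 2)).
rewrite [X in x * (X + _)]big1 ?add0r; last by move=> i _; rewrite odd_double expr0n mulr0.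
rewrite [X in _ = X + _]big1 ?add0r; last first.
  by move=> i _; rewrite /= !negbK odd_double subrr expr0n mulr0.
rewrite (eq_bigr (fun i : 'I_m.+1 => ME i * (shoot ME SE i).[x] ^+ 2)); last first.
  by move=> i _; rewrite /= odd_double uphalf_double.
rewrite [RHS](eq_bigr (fun i : 'I_m.+1 => SE i * ((shoot ME SE i).[x] - (shoot ME SE i.+1).[x]) ^+ 2)).
  exact: (massform_eq_energyform se0 xr).
by move=> i _; rewrite /= !negbK odd_double /= uphalf_double.
Qed.

Lemma markov_odd m : exists mu1 : R, smallest_root (Pt lam m.+1) mu1 /\
  markov_const m.*2.+1 lam = 2 / Num.sqrt mu1.
Proof.
have [x xmin xpos] := shoot_smallest_root mo0 so0 m; exists x; split.
  exact: smallest_root_Prec mo0 so0 (alphat_sqr hlam) (betat_sqrV hlam) xmin.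
have [xr _] := xmin; have x0 := shoot_root_gt0 mo0 so0 xr.
have pos k : (k <= m)%N -> 0 < (shoot MO SO k).[x] by move=> km; apply: xpos.
have HO z : z m.+1 = 0 -> x * massform MO m.+1 z <= energyform SO m.+1 z.
  exact: massform_le_energyform.
have sumS (F : nat -> R) : \sum_(i < m.*2.+1) F i =
  \sum_(i < m.+1) F i.*2 + \sum_(i < m) F i.*2.+1.
  by rewrite big_ord_recr/= sum_double [X in _ = X + _]big_ord_recr/=; ring.
apply: markov_const_eq => //.
  move=> y yn yn1; rewrite (sumS (fun i => phi2 lam i * y i ^+ 2)).
  rewrite (sumS (fun i => hsq lam i.+1 * (y i - y i.+2) ^+ 2)) mulrDr; apply: lerD.
    by apply: (HO (fun i => y i.*2)).
  by apply: (even_le_odd hlam (ltW x0) HO (z := fun i => y i.*2.+1)).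
exists (fun i => if odd i then 0 else (shoot MO SO i./2).[x]); split.
- by rewrite /= odd_double.
- by rewrite /= negbK odd_double /= doubleK; exact/rootP.
- rewrite (sumS (fun i => phi2 lam i * (if odd i then 0 else (shoot MO SO i./2).[x]) ^+ 2)).
  rewrite [X in _ + X]big1 ?addr0; last by move=> i _; rewrite /= odd_double expr0n mulr0.
  rewrite (eq_bigr (fun i : 'I_m.+1 => MO i * (shoot MO SO i).[x] ^+ 2)); first exact: massform_shoot_gt0.
  by move=> i _; rewrite /= odd_double doubleK.
rewrite (sumS (fun i => phi2 lam i * (if odd i then 0 else (shoot MO SO i./2).[x]) ^+ 2)).
rewrite (sumS (fun i => hsq lam i.+1 * ((if odd i then 0 else (shoot MO SO i./2).[x]) -
   (if odd i.+2 then 0 else (shoot MO SO i.+2./2).[x])) ^+ 2)).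
rewrite [X in x * (_ + X)]big1 ?addr0; last by move=> i _; rewrite /= odd_double expr0n mulr0.
rewrite [X in _ = _ + X]big1 ?addr0; last first.
  by move=> i _; rewrite /= !negbK odd_double subrr expr0n mulr0.
rewrite (eq_bigr (fun i : 'I_m.+1 => MO i * (shoot MO SO i).[x] ^+ 2)); last first.
  by move=> i _; rewrite /= odd_double doubleK.
rewrite [RHS](eq_bigr (fun i : 'I_m.+1 => SO i * ((shoot MO SO i).[x] - (shoot MO SO i.+1).[x]) ^+ 2)).
  exact: (massform_eq_energyform so0 xr).
by move=> i _; rewrite /= !negbK odd_double /= doubleK.
Qed.

End MarkovConstant.

(** * The moment functional of the Jacobi operator of a string *)

Section MomentFunctional.
Variable R : realType.

Definition linext (s : nat -> R) (p : {poly R}) : R := \sum_(i < size p) p`_i * s i.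

Lemma linextE s (p : {poly R}) n : (size p <= n)%N -> linext s p = \sum_(i < n) p`_i * s i.
Proof.
move=> pn; rewrite /linext (big_ord_widen n (fun i => p`_i * s i) pn) big_mkcond.
by apply: eq_bigr => i _; case: ltnP => // h; rewrite nth_default ?mul0r.
Qed.

Lemma linextD s (p q : {poly R}) : linext s (p + q) = linext s p + linext s q.
Proof.
have h := size_polyD p q; set n := maxn _ _ in h.
rewrite (linextE _ h) (@linextE s p n) ?leq_maxl// (@linextE s q n) ?leq_maxr// -big_split/=.
by apply: eq_bigr => i _; rewrite coefD mulrDl.
Qed.

Lemma linextZ s c (p : {poly R}) : linext s (c *: p) = c * linext s p.
Proof.
rewrite (linextE _ (size_scale_leq c p)) /linext mulr_sumr.
by apply: eq_bigr => i _; rewrite coefZ mulrA.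
Qed.

Lemma linext0 s : linext s 0 = 0.
Proof. by rewrite /linext size_poly0 big_ord0. Qed.

Lemma linext_sum s I (r : seq I) (F : I -> {poly R}) :
  linext s (\sum_(i <- r) F i) = \sum_(i <- r) linext s (F i).
Proof. by elim/big_rec2: _ => [|i _ y _ <-]; rewrite ?linext0 ?linextD. Qed.

Lemma linextXn s n : linext s 'X^n = s n.
Proof.
rewrite /linext size_polyXn big_ord_recr/= coefXn eqxx mul1r big1 ?add0r// => i _.
by rewrite coefXn ltn_eqF ?mul0r.
Qed.

Lemma linextXM s (p : {poly R}) : linext s ('X * p) = linext (fun i => s i.+1) p.
Proof.
rewrite (@linextE s _ (size p).+1); last first.
  rewrite mulrC; have [->|p0] := eqVneq p 0; first by rewrite mul0r size_poly0.
  by rewrite size_mulX.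
rewrite big_ord_recl coefXM mul0r add0r /linext.
by apply: eq_bigr => i _; rewrite coefXM.
Qed.

Lemma poly_expand (p : {poly R}) : p = \sum_(i < size p) p`_i *: 'X^i.
Proof. by rewrite -[LHS]coefK poly_def. Qed.

Lemma linextM s (p q : {poly R}) : linext s (p * q) =
  \sum_(i < size p) \sum_(j < size q) p`_i * q`_j * s (i + j)%N.
Proof.
rewrite {1}(poly_expand p) mulr_suml linext_sum; apply: eq_bigr => i _.
have E : 'X^i * q = \sum_(j < size q) q`_j *: 'X^(i + j).
  rewrite {1}(poly_expand q) mulr_sumr; apply: eq_bigr => j _.
  by rewrite -scalerAr exprD.
rewrite -scalerAl linextZ E linext_sum mulr_sumr.
by apply: eq_bigr => j _; rewrite linextZ linextXn mulrA.
Qed.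

Section StringOperator.
Variables a b : nat -> R.
Hypotheses (a_gt0 : forall i, 0 < a i) (b_gt0 : forall i, 0 < b i).

(** The Jacobi operator J whose eigenvector equation J u = x u is the shooting recurrence; it is
    symmetric for the weights [a]. *)
Definition stringop (u : nat -> R) (k : nat) : R :=
  (a k)^-1 * (b k * (u k - u k.+1) - (if k is k'.+1 then b k' * (u k' - u k) else 0)).

Lemma stringopE u k : stringop u k =
  (a k)^-1 * (b k * (u k - u k.+1) - (if k is k'.+1 then b k' * (u k' - u k) else 0)).
Proof. by []. Qed.

Lemma stringop_sum n (c : nat -> R) (U : nat -> nat -> R) k :
  stringop (fun k => \sum_(i < n) c i * U i k) k = \sum_(i < n) c i * stringop (U i) k.
Proof.
elim: n => [|n ih].
  by rewrite stringopE; case: k => [|k]; rewrite !big_ord0 !subrr !mulr0 subrr mulr0.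
rewrite big_ord_recr/= -ih !stringopE.
by case: k {ih} => [|k]; rewrite !big_ord_recr/=; ring.
Qed.

Let e0 (k : nat) : R := (k == 0%N)%:R.
(** The vectors J^i e_0. They are finitely supported ([orb_supp]), so every pairing is a finite sum
    and no Hilbert space is involved. *)
Let orb i := iter i stringop e0.

Lemma stringop_green u v n : v n = 0 ->
  \sum_(k < n) a k * stringop u k * v k =
  \sum_(k < n) b k * (u k - u k.+1) * (v k - v k.+1).
Proof.
case: n => [|n] vn; first by rewrite !big_ord0.
suff H m : \sum_(k < m.+1) a k * stringop u k * v k =
    \sum_(k < m.+1) b k * (u k - u k.+1) * (v k - v k.+1) + b m * (u m - u m.+1) * v m.+1.
  by rewrite H vn mulr0 addr0.
have ae k x : a k * ((a k)^-1 * x) = x by rewrite mulVKf// gt_eqF.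
elim: m => [|m ih]; first by rewrite !big_ord_recr !big_ord0 /= stringopE ae; ring.
by rewrite big_ord_recr/= ih [in RHS]big_ord_recr/= stringopE ae; ring.
Qed.

Let orb_supp i k : (i < k)%N -> orb i k = 0.
Proof.
elim: i k => [|i ih] [|k] // ik.
rewrite -[orb i.+1 k.+1]/(stringop (orb i) k.+1) stringopE (ih k.+2) ?(ih k.+1) ?(ih k)//.
- by rewrite !subrr !mulr0 subrr mulr0.
- exact: ltnW.
- by rewrite ltnW// ltnW.
Qed.

Definition stringmoment i := orb i 0.

(** Two applications of [stringop_green] move one power of J from the left vector to the right one,
    until the left vector is e_0; the bound on n keeps the cut-off outside the supports. *)
Let orb_pair i j n : (i + j < n)%N -> \sum_(k < n) a k * orb i k * orb j k = a 0 * stringmoment (i + j).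
Proof.
elim: i j => [|i ih] j ijn.
  case: n ijn => // n _; rewrite big_ord_recl /orb /= mulr1 big1 ?addr0// => k _.
  by rewrite /e0 /= mulr0 mul0r.
rewrite addSnnS -ih ?addnS// /orb /= -/(orb i) -/(orb j).
rewrite stringop_green; last by rewrite orb_supp// (leq_ltn_trans _ ijn)// leq_addl.
have -> : \sum_(k < n) a k * orb i k * stringop (orb j) k = \sum_(k < n) a k * stringop (orb j) k * orb i k.
  by apply: eq_bigr => k _; ring.
rewrite stringop_green; last by rewrite orb_supp// (leq_ltn_trans _ ijn)// addSn ltnW// ltnS leq_addr.
by apply: eq_bigr => k _; ring.
Qed.

Let orb_dirichlet i j n : (i + j < n)%N ->
  \sum_(k < n) b k * (orb i k - orb i k.+1) * (orb j k - orb j k.+1) = a 0 * stringmoment (i + j).+1.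
Proof.
move=> ijn; rewrite -stringop_green; last by rewrite orb_supp// (leq_ltn_trans _ ijn)// leq_addl.
have -> : \sum_(k < n) a k * stringop (orb i) k * orb j k = \sum_(k < n.+1) a k * orb i.+1 k * orb j k.
  by rewrite big_ord_recr/= [orb j n]orb_supp ?mulr0 ?addr0// (leq_ltn_trans _ ijn)// leq_addl.
by rewrite orb_pair ?addSn.
Qed.

Definition momentfun := linext stringmoment.
(** The components of p(J) e_0, so that [momentfun] is the spectral functional of the vector e_0. *)
Definition coords (p : {poly R}) k := linext (fun i => orb i k) p.

Lemma coordsX (p : {poly R}) k : coords ('X * p) k = stringop (coords p) k.
Proof.
by rewrite /coords linextXM /linext stringop_sum.
Qed.

Let bilin (c : nat -> R) (A : nat -> nat -> R) (q p : {poly R}) n :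
  \sum_(k < n) c k * (\sum_(i < size p) p`_i * A i k) * (\sum_(j < size q) q`_j * A j k) =
  \sum_(i < size p) \sum_(j < size q) p`_i * q`_j * \sum_(k < n) c k * A i k * A j k.
Proof.
under eq_bigr => k _.
  rewrite -mulrA big_distrlr /= mulr_sumr.
  under eq_bigr do rewrite mulr_sumr.
  over.
rewrite exchange_big/=; apply: eq_bigr => i _; rewrite exchange_big/=; apply: eq_bigr => j _.
by rewrite mulr_sumr; apply: eq_bigr => k _; ring.
Qed.

Lemma momentfun_coords (p q : {poly R}) n : (size p + size q <= n)%N ->
  a 0 * momentfun (p * q) = \sum_(k < n) a k * coords p k * coords q k.
Proof.
move=> pqn; rewrite /coords /linext (bilin a orb) /momentfun linextM mulr_sumr; apply: eq_bigr => i _.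
rewrite mulr_sumr; apply: eq_bigr => j _; rewrite orb_pair; first by ring.
by rewrite (leq_trans _ pqn)// -addSn leq_add// ltnW.
Qed.

Lemma momentfunX_coords (p q : {poly R}) n : (size p + size q <= n)%N ->
  a 0 * momentfun ('X * (p * q)) = \sum_(k < n) b k * (coords p k - coords p k.+1) * (coords q k - coords q k.+1).
Proof.
move=> pqn; rewrite /coords.
have E (r : {poly R}) k : linext (fun i => orb i k) r - linext (fun i => orb i k.+1) r =
    \sum_(i < size r) r`_i * (orb i k - orb i k.+1).
  by rewrite /linext -sumrB; apply: eq_bigr => i _; rewrite mulrBr.
under [RHS]eq_bigr do rewrite !E.
rewrite (bilin b (fun i k => orb i k - orb i k.+1)) /momentfun linextXM linextM mulr_sumr.
apply: eq_bigr => i _; rewrite mulr_sumr; apply: eq_bigr => j _; rewrite orb_dirichlet; first by ring.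
by rewrite (leq_trans _ pqn)// -addSn leq_add// ltnW.
Qed.

Lemma momentfun_sqr_ge0 (p : {poly R}) : 0 <= momentfun (p ^+ 2).
Proof.
rewrite -(pmulr_rge0 _ (a_gt0 0)) expr2 (momentfun_coords (leqnn _)); apply: sumr_ge0 => k _.
by rewrite -mulrA mulr_ge0 ?(ltW (a_gt0 _))// -expr2 sqr_ge0.
Qed.

Lemma momentfunX_sqr_ge0 (p : {poly R}) : 0 <= momentfun ('X * p ^+ 2).
Proof.
rewrite -(pmulr_rge0 _ (a_gt0 0)) expr2 (momentfunX_coords (leqnn _)); apply: sumr_ge0 => k _.
by rewrite -mulrA mulr_ge0 ?(ltW (b_gt0 _))// -expr2 sqr_ge0.
Qed.

(** Of the factor 4, one 2 comes from (u - v)^2 <= 2 u^2 + 2 v^2 and the other from each mass being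
    adjacent to at most two springs. *)
Lemma momentfunX_sqr_le c (p : {poly R}) : (forall k, b k <= c * a k) -> (forall k, b k <= c * a k.+1) ->
  momentfun ('X * p ^+ 2) <= 4 * c * momentfun (p ^+ 2).
Proof.
move=> c1 c2; rewrite -(ler_pM2l (a_gt0 0)) [leRHS]mulrCA expr2.
set n := (size p + size p)%N.
rewrite (momentfunX_coords (leqnn _)) (momentfun_coords (leqnSn n)) -/n; set v := coords p.
apply: (@le_trans _ _ (\sum_(k < n) (2 * c * (a k * v k ^+ 2) + 2 * c * (a k.+1 * v k.+1 ^+ 2)))).
  apply: ler_sum => k _; rewrite -mulrA -expr2.
  have h : (v k - v k.+1) ^+ 2 <= 2 * v k ^+ 2 + 2 * v k.+1 ^+ 2.
    rewrite -subr_ge0 [leRHS](_ : _ = (v k + v k.+1) ^+ 2) ?sqr_ge0//; ring.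
  apply: le_trans (ler_wpM2l (ltW (b_gt0 k)) h) _; rewrite mulrDr.
  apply: lerD; rewrite mulrCA -[leRHS]mulrA ler_pM2l// mulrA ler_wpM2r ?sqr_ge0//.
have v2 k : 0 <= a k * v k ^+ 2 by rewrite mulr_ge0 ?sqr_ge0 ?(ltW (a_gt0 k)).
have c0 : 0 <= c by rewrite -(pmulr_lge0 _ (a_gt0 0)) (le_trans _ (c1 0))// ltW.
rewrite big_split/= -!mulr_sumr.
have h1 : \sum_(k < n) a k * v k ^+ 2 <= \sum_(k < n.+1) a k * v k * v k.
  rewrite [leRHS](eq_bigr (fun k : 'I_n.+1 => a k * v k ^+ 2)); last by move=> k _; rewrite expr2 mulrA.
  by rewrite big_ord_recr/= lerDl.
have h2 : \sum_(k < n) a k.+1 * v k.+1 ^+ 2 <= \sum_(k < n.+1) a k * v k * v k.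
  rewrite [leRHS](eq_bigr (fun k : 'I_n.+1 => a k * v k ^+ 2)); last by move=> k _; rewrite expr2 mulrA.
  by rewrite big_ord_recl/= lerDr.
rewrite (_ : 4 * c = 2 * c + 2 * c); last by ring.
have cc : 0 <= 2 * c by rewrite mulr_ge0.
by apply: le_trans (lerD (ler_wpM2l cc h1) (ler_wpM2l cc h2)) _; rewrite -mulrDl.
Qed.

(** The vector p(J) e_0 for p = [shoot k] is a multiple of the unit vector e_k, so orthogonality of
    the polynomials is orthogonality of unit vectors. The step vector of [flux k] is what drives the
    induction: J sends it to a combination of e_k and e_{k+1}. *)
Lemma coords_shoot k i : coords (shoot a b k) i = a 0 / a k * (i == k)%:R /\
  coords (flux a b k) i = a 0 * (i <= k)%:R.
Proof.
have T1 : true%:R = 1 :> R by [].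
have F0 : false%:R = 0 :> R by [].
have cD p q j : coords (p + q) j = coords p j + coords q j by exact: linextD.
have cZ c p j : coords (c *: p) j = c * coords p j by exact: linextZ.
elim: k i => [|k ih] i.
  have c1 : coords 1 i = (i == 0%N)%:R.
    by rewrite -[1]/('X^0) /coords linextXn.
  have aa : a 0 / a 0 = 1 by rewrite divff// gt_eqF.
  rewrite shoot0 flux0 aa mul1r leqn0; split; first exact: c1.
  by rewrite -[(a 0)%:P]mulr1 mul_polyC cZ c1.
have ak j : a j != 0 by rewrite gt_eqF.
have bk j : b j != 0 by rewrite gt_eqF.
have h : coords (shoot a b k.+1) i = a 0 / a k.+1 * (i == k.+1)%:R.
  rewrite shootS cD -scaleNr cZ coordsX (ih i).1 /stringop.
  have -> : b i * (coords (flux a b k) i - coords (flux a b k) i.+1) = a 0 * b k * (i == k)%:R.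
    rewrite (ih i).2 (ih i.+1).2; have [->|ik] := eqVneq i k; first by rewrite leqnn ltnn T1 F0; ring.
    have -> : (i < k)%N = (i <= k)%N by rewrite ltn_neqAle ik.
    by rewrite subrr !mulr0.
  have -> : (if i is k'.+1 then b k' * (coords (flux a b k) k' - coords (flux a b k) i) else 0)
     = a 0 * b k * (i == k.+1)%:R.
    case: i => [|i]; first by rewrite F0 mulr0.
    rewrite (ih i).2 (ih i.+1).2 eqSS; have [->|ik] := eqVneq i k; first by rewrite leqnn ltnn T1 F0; ring.
    have -> : (i < k)%N = (i <= k)%N by rewrite ltn_neqAle ik.
    by rewrite subrr !mulr0.
  have [->|ik] := eqVneq i k; first by rewrite eqn_leq ltnn andbF T1 F0; field; rewrite ?ak ?bk.
  by have [->|ik1] := eqVneq i k.+1; rewrite ?T1 ?F0; field; rewrite ?ak ?bk.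
split => //; rewrite fluxS cD cZ h (ih i).2 [in RHS]leq_eqVlt ltnS.
have [->|ik] := eqVneq i k.+1; last by rewrite /= F0; field; rewrite ak.
by rewrite ltnn/= T1 F0; field; rewrite ak.
Qed.

Lemma momentfun_shoot j k : momentfun (shoot a b j * shoot a b k) = (j == k)%:R * (a 0 / a k).
Proof.
apply: (mulfI (_ : a 0 != 0)); first by rewrite gt_eqF.
set n := (size (shoot a b j) + size (shoot a b k) + k.+1)%N.
rewrite (@momentfun_coords _ _ n) ?leq_addr//.
have kn : (k < n)%N by rewrite /n leq_addl.
rewrite (bigD1 (Ordinal kn)) //= big1 ?addr0 => [|i ik]; last first.
  by rewrite (coords_shoot k i).1 (_ : (i == k :> nat) = false) ?mulr0//; exact: negbTE.
rewrite (coords_shoot k k).1 (coords_shoot j k).1 eqxx eq_sym.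
have [->|jk] := eqVneq j k; last by rewrite !(mulr0,mul0r).
by rewrite (_ : true%:R = 1 :> R)//; field; rewrite gt_eqF.
Qed.

Lemma momentfun1 : momentfun 1 = 1.
Proof. by have := momentfun_shoot 0 0; rewrite shoot0 mulr1 => ->; rewrite mul1r divff// gt_eqF. Qed.

(** Even powers are absorbed into a square, which leaves four parity cases. The mixed one uses C x
    (C - x) = (C - x) x^2 + x (C - x)^2. *)
Lemma momentfun_bernstein_ge0 C k l : 0 < C -> (forall p, momentfun ('X * p ^+ 2) <= C * momentfun (p ^+ 2)) ->
  0 <= momentfun ('X^k * (C%:P - 'X) ^+ l).
Proof.
move=> C0 HC.
have LD p q : momentfun (p + q) = momentfun p + momentfun q by exact: linextD.
have LZ c p : momentfun (c *: p) = c * momentfun p by exact: linextZ.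
have LC q : 0 <= momentfun ((C%:P - 'X) * q ^+ 2).
  rewrite mulrBl LD -scaleN1r LZ mul_polyC LZ mulN1r subr_ge0; exact: HC.
have LXC q : 0 <= momentfun ('X * (C%:P - 'X) * q ^+ 2).
  have e : C *: ('X * (C%:P - 'X) * q ^+ 2) =
    (C%:P - 'X) * ('X * q) ^+ 2 + 'X * ((C%:P - 'X) * q) ^+ 2 by rewrite -mul_polyC; ring.
  by rewrite -(pmulr_rge0 _ C0) -LZ e LD addr_ge0 ?momentfunX_sqr_ge0.
rewrite -(odd_double_half k) -(odd_double_half l) !exprD -!muln2 !exprM.
set u := 'X ^+ k./2; set v := (C%:P - 'X) ^+ l./2.
case: (odd k); case: (odd l); rewrite ?expr1 ?expr0.
- by rewrite mulrACA -exprMn LXC.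
- by rewrite mul1r -mulrA -exprMn momentfunX_sqr_ge0.
- by rewrite mul1r mulrCA -exprMn LC.
- by rewrite !mul1r -exprMn momentfun_sqr_ge0.
Qed.

End StringOperator.
End MomentFunctional.

(** * Hausdorff's moment theorem by quantile functions *)

Section HausdorffMoment.
Variable R : realType.
Let mu := @lebesgue_measure R.

Lemma integrable_nondecreasing (f : R -> R) (i : interval R) (s t : R) :
  nondecreasing_fun f -> [set` i] `<=` `[s, t]%classic ->
  mu.-integrable [set` i] (EFin \o f).
Proof.
move=> f_nd ist.
apply: (@measurable_bounded_integrable _ _ _ mu f _ (measurable_itv i)).
- apply: (@le_lt_trans _ _ (mu `[s, t]%classic)).
    by apply: le_measure; rewrite ?inE//; exact: measurable_itv.
  by rewrite /mu lebesgue_measure_itv/=; case: ifP => _; rewrite ltry.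
- exact: nondecreasing_measurable (measurable_itv i) f_nd.
- exists (Num.max `|f s| `|f t|); split; first exact: num_real.
  move=> M hM x /ist; rewrite /= in_itv/= => /andP[sx xt].
  have := hM; rewrite gt_max => /andP[h1 h2]; rewrite ler_norml.
  have := f_nd _ _ sx; have := f_nd _ _ xt.
  move: h1 h2; rewrite !ltr_norml => /andP[a b] /andP[c d] e g.
  by apply/andP; split; lra.
Qed.

Lemma fine_lebesgue_Ioc (s t : R) : s <= t -> fine (mu `]s, t]%classic) = t - s.
Proof.
move=> st; rewrite /mu lebesgue_measure_itv/= lte_fin; have [//|ts] := ltP s t.
by rewrite (le_anti (introT andP (conj st ts))) subrr.
Qed.

Section RiemannSum.
Variable f : R -> R.
Hypothesis f_nd : nondecreasing_fun f.

Let itv_bounds (s t : R) : s <= t ->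
  f s * (t - s) <= \int[mu]_(x in `]s, t]) f x <= f t * (t - s).
Proof.
move=> st.
have ioc : `]s, t]%classic `<=` `[s, t]%classic.
  by move=> x /=; rewrite !in_itv/= => /andP[/ltW -> ->].
have fi := integrable_nondecreasing f_nd ioc.
have ci c := integrable_nondecreasing (fun x y _ => lexx c : (fun=> c) x <= (fun=> c) y) ioc.
rewrite -(fine_lebesgue_Ioc st) -!Rintegral_cst//; try exact: measurable_itv.
apply/andP; split; apply: le_Rintegral => //; try exact: measurable_itv.
- by move=> x; rewrite /= in_itv/= => /andP[/ltW sx _]; exact: f_nd.
- by move=> x; rewrite /= in_itv/= => /andP[_ xt]; exact: f_nd.
Qed.

Lemma Rintegral_itv_split (t u : R) : 0 <= t -> t <= u ->
  \int[mu]_(x in `[0, u]) f x = \int[mu]_(x in `[0, t]) f x + \int[mu]_(x in `]t, u]) f x.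
Proof.
move=> t0 tu; rewrite -(@Rintegral_itvB _ f (BLeft 0) (BRight u) t).
- by rewrite addrC subrK.
- by apply: integrable_nondecreasing f_nd (@subset_refl _ _).
- by rewrite bnd_simp.
- by rewrite bnd_simp.
Qed.

(** The integral lies between the left and the right Riemann sum, whose difference telescopes. *)
Lemma riemann_sum_monotone N : (0 < N)%N ->
  `|\int[mu]_(x in `[0, 1]) f x - N%:R^-1 * \sum_(i < N) f (i.+1%:R / N%:R)| <=
  (f 1 - f 0) / N%:R.
Proof.
move=> N0; have Np : 0 < N%:R :> R by rewrite ltr0n.
pose g i := f (i%:R / N%:R).
have H m : N%:R^-1 * \sum_(i < m) g i <= \int[mu]_(x in `[0, m%:R / N%:R]) f x <= N%:R^-1 * \sum_(i < m) g i.+1.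
  elim: m => [|m /andP[ih1 ih2]].
    by rewrite !big_ord0 mulr0 mul0r set_itv1 Rintegral_set1 lexx.
  have e : m.+1%:R / N%:R - m%:R / N%:R = N%:R^-1 :> R by rewrite -mulrBl -addn1 natrD addrC addKr mul1r.
  have st : m%:R / N%:R <= m.+1%:R / N%:R :> R by rewrite ler_pM2r ?invr_gt0// ler_nat.
  have /andP[b1 b2] := itv_bounds st; rewrite e in b1 b2.
  rewrite (@Rintegral_itv_split (m%:R / N%:R))// ?divr_ge0//.
  rewrite !big_ord_recr/= !mulrDr ![N%:R^-1 * g _]mulrC.
  by apply/andP; split; apply: lerD.
have := H N; rewrite divff ?gt_eqF// => /andP[h1 h2].
have tele : \sum_(i < N) g i.+1 - \sum_(i < N) g i = f 1 - f 0.
  by rewrite -sumrB -(big_mkord xpredT (fun i => g i.+1 - g i)) telescope_sumr// /g divff ?gt_eqF// mul0r.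
rewrite distrC ger0_norm ?subr_ge0//.
by rewrite [leRHS]mulrC -tele mulrBr lerD2l lerN2.
Qed.

End RiemannSum.

Lemma riemann_sum_step (c : R) N : 0 <= c <= 1 -> (0 < N)%N ->
  `|(1 - c) - N%:R^-1 * \sum_(i < N) (c < i.+1%:R / N%:R)%R%:R| <= N%:R^-1.
Proof.
move=> /andP[c0 c1] N0.
pose f (u : R) : R := (c < u)%R%:R.
have fnd : nondecreasing_fun f.
  move=> x y xy; rewrite /f; case: (ltP c x) => [cx|_]; last exact: ler0n.
  by rewrite (lt_le_trans cx xy).
have -> : 1 - c = \int[mu]_(x in `[0, 1]) f x.
  rewrite (Rintegral_itv_split fnd c0 c1) (@eq_Rintegral _ _ _ mu `[0, c]%classic (fun=> 0) f); last first.
    by move=> x; rewrite inE/= in_itv/= => /andP[_ xc]; rewrite /f ltNge xc.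
  rewrite (@eq_Rintegral _ _ _ mu `]c, 1]%classic (fun=> 1) f); last first.
    by move=> x; rewrite inE/= in_itv/= => /andP[cx _]; rewrite /f cx.
  rewrite !Rintegral_cst; try exact: measurable_itv.
  by rewrite mul0r add0r mul1r; apply/esym; exact: fine_lebesgue_Ioc.
apply: le_trans (riemann_sum_monotone fnd N0) _.
rewrite ler_pdivrMr ?ltr0n// mulVf ?pnatr_eq0 -?lt0n//.
have -> : f 0 = 0 by rewrite /f ltNge c0.
by rewrite subr0 /f; case: (c < 1)%R; rewrite ?ler01.
Qed.

(** As [F] is monotone, the indicator selects an initial segment of indices and the sum telescopes
    up to its length. *)
Lemma step_sum (F G : nat -> R) (u : R) n :
  {homo F : i j / (i <= j)%N >-> i <= j} ->
  \sum_(k < n) (G k.+1 - G k) * (F k < u)%R%:R = G (\sum_(k < n) (F k < u)%R)%N - G 0.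
Proof.
move=> Fh; elim: n => [|n ih]; first by rewrite !big_ord0 subrr.
rewrite !big_ord_recr/= ih; have [Fn|Fn] := ltP (F n) u; last by rewrite mulr0 addr0 addn0.
have -> : (\sum_(k < n) (F k < u)%R)%N = n.
  rewrite (eq_bigr (fun=> 1%N)) ?sum_nat_const ?card_ord ?muln1// => i _.
  by rewrite (le_lt_trans _ Fn)// Fh// ltnW.
by rewrite (_ : true%:R = 1 :> R)// mulr1 addn1; ring.
Qed.

Lemma abel_weights (w G : nat -> R) m : \sum_(k < m.+1) w k * G k =
  (\sum_(k < m.+1) w k) * G m - \sum_(k < m) (G k.+1 - G k) * (\sum_(i < k.+1) w i).
Proof.
elim: m => [|m ih]; first by rewrite !big_ord_recr !big_ord0 /= subr0 !add0r.
rewrite big_ord_recr/= ih [in RHS]big_ord_recr/= [X in _ = _ - X]big_ord_recr/=; ring.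
Qed.

(** The Bernstein weights have exact falling-factorial moments, whereas powers are wanted. Both
    ratios are products of j factors in [0, 1], and corresponding factors differ by at most 2J/n
    because [J.*2 <= n] keeps n - j above n/2. *)
Lemma ffact_ratio_bound (n k j J : nat) : (0 < J)%N -> (J.*2 <= n)%N -> (k <= n)%N -> (j <= J)%N ->
  `|(k%:R / n%:R) ^+ j - (k ^_ j)%:R / (n ^_ j)%:R| <= (J.*2 * j)%:R / n%:R :> R.
Proof.
move=> J0 Jn kn.
have n0 : (0 < n)%N by rewrite (leq_trans _ Jn)// double_gt0.
have np : 0 < n%:R :> R by rewrite ltr0n.
elim: j => [|j ih] jJ.
  by rewrite !ffactn0 expr0 divr1 subrr normr0 muln0 mul0r.
have {}ih := ih (ltnW jJ).
have jn : (j < n)%N by rewrite (leq_trans jJ)// (leq_trans _ Jn)// -addnn leq_addr.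
have nj : 0 < (n - j)%:R :> R by rewrite ltr0n subn_gt0.
have ffp : 0 < (n ^_ j)%:R :> R by rewrite ltr0n ffact_gt0 ltnW.
rewrite exprSr !ffactnSr !natrM -[X in _ - X]mulf_div.
set x : R := (k%:R / n%:R) in ih *; set y := _ / (n ^_ j)%:R in ih *.
set z := _ / (n - j)%:R.
have x1 : 0 <= x <= 1 by rewrite divr_ge0//= ler_pdivrMr// mul1r ler_nat.
have y1 : 0 <= y <= 1.
  by rewrite divr_ge0//= ler_pdivrMr// mul1r ler_nat !ffact_prod; apply: leq_prod => i _; exact: leq_sub2r.
have xz : `|x - z| <= J.*2%:R / n%:R.
  have [jk|kj] := leqP j k; last first.
    have -> : z = 0 by rewrite /z (eqP (ltnW kj : (k - j == 0)%N)) mul0r.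
    rewrite subr0 ger0_norm; last by case/andP: x1.
    rewrite ler_pM2r ?invr_gt0// ler_nat (leq_trans (ltnW kj))// (leq_trans (ltnW jJ))//.
    by rewrite -addnn leq_addr.
  have -> : x - z = j%:R * (n - k)%:R / (n%:R * (n - j)%:R).
    move: nj; rewrite /x /z !natrB ?(ltnW jn)// => nj.
    by field; rewrite (gt_eqF nj) (gt_eqF np).
  rewrite ger0_norm ?divr_ge0 ?mulr_ge0//.
  rewrite invfM [n%:R^-1 * _]mulrC !mulrA ler_pM2r ?invr_gt0// ler_pdivrMr//.
  rewrite -!natrM ler_nat -muln2 -mulnA; apply: leq_mul; first exact: ltnW.
  rewrite (leq_trans (leq_subr _ _))// mulnC muln2 -addnn.
  rewrite -[X in (X <= _)%N](subnK (ltnW jn)) leq_add2l -(leq_add2r j) subnK ?(ltnW jn)// addnn.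
  by rewrite (leq_trans _ Jn)// leq_double ltnW.
have -> : x ^+ j * x - y * z = (x ^+ j - y) * x + y * (x - z) by ring.
apply: le_trans (ler_normD _ _) _; rewrite (normrM _ x) (normrM y) -[j.+1]add1n natrD mulrDr mulr1 mulrDl addrC -natrM.
case/andP: x1 => x0 x1; case/andP: y1 => y0 y1.
rewrite (ger0_norm x0) (ger0_norm y0); apply: lerD.
  by apply: le_trans xz; rewrite ler_piMl.
by apply: le_trans ih; rewrite ler_piMr.
Qed.

Lemma bin_ffact_shift n i j : (i + j <= n)%N ->
  ('C(n, i + j) * (i + j) ^_ j = n ^_ j * 'C(n - j, i))%N.
Proof.
move=> ijn.
have h : (0 < i`! * (n - j - i)`!)%N by rewrite muln_gt0 !fact_gt0.
have jn : (j <= n)%N by apply: leq_trans ijn; rewrite leq_addl.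
apply/eqP; rewrite -(eqn_pmul2r h); apply/eqP.
have ij : (i <= n - j)%N by rewrite leq_subRL// addnC.
rewrite -[RHS]mulnA bin_fact// ffact_fact//.
have := ffact_fact (leq_addl i j); rewrite addnK => e.
rewrite mulnA -[(_ * _ * i`!)%N]mulnA e -mulnA -subnDA [(j + i)%N]addnC bin_fact//.
Qed.

(** When A + B is constant, the right side is a multiple of A^j: this evaluates the
    falling-factorial moments of the Bernstein weights. *)
Lemma bernstein_ffact (A B : {poly R}) n j : (j <= n)%N ->
  \sum_(k < n.+1) (('C(n, k) * k ^_ j)%:R : R) *: (A ^+ k * B ^+ (n - k)) =
  (n ^_ j)%:R *: (A ^+ j * (A + B) ^+ (n - j)).
Proof.
move=> jn.
rewrite -(big_mkord xpredT (fun k => (('C(n, k) * k ^_ j)%:R : R) *: (A ^+ k * B ^+ (n - k)))).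
rewrite (@big_cat_nat _ _ _ j)//=; last exact: leqW.
rewrite big_nat_cond big1 ?add0r; last first.
  by move=> k /andP[/andP[_ kj] _]; rewrite ffact_small// muln0 scale0r.
rewrite -{1}[j]add0n big_addn subSn// big_mkord [A + B]addrC exprDn mulr_sumr scaler_sumr.
apply: eq_bigr => i _.
have ij : (i <= n - j)%N by rewrite -ltnS.
have ijn : (i + j <= n)%N by rewrite addnC -leq_subRL.
rewrite bin_ffact_shift// natrM -scalerA; congr (_ *: _).
rewrite [in RHS]mulrnAr scaler_nat; congr (_ *+ _).
by rewrite mulrCA -exprD mulrC [(i + j)%N]addnC subnDA.
Qed.

Section Hausdorff.
Variables (Lf : {poly R} -> R) (C : R).
Hypothesis LD : forall p q, Lf (p + q) = Lf p + Lf q.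
Hypothesis LZ : forall c p, Lf (c *: p) = c * Lf p.
Hypothesis Lf1 : Lf 1 = 1.
Hypothesis C0 : 0 < C.
Hypothesis Lpos : forall k l, 0 <= Lf ('X^k * (C%:P - 'X) ^+ l).

Let w n k := 'C(n, k)%:R * Lf ('X^k * (C%:P - 'X) ^+ (n - k)) / C ^+ n.

Let w_ge0 n k : 0 <= w n k.
Proof. by rewrite /w divr_ge0 ?exprn_ge0 ?(ltW C0)// mulr_ge0. Qed.

Let w_ffact n j : (j <= n)%N ->
  \sum_(k < n.+1) w n k * (k ^_ j)%:R = (n ^_ j)%:R * Lf 'X^j / C ^+ j.
Proof.
move=> jn; have := congr1 Lf (bernstein_ffact 'X (C%:P - 'X) jn).
have Lsum m (f : nat -> {poly R}) : Lf (\sum_(i < m) f i) = \sum_(i < m) Lf (f i).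
  elim: m => [|m ih]; last by rewrite !big_ord_recr/= LD ih.
  by rewrite !big_ord0; have := LZ 0 0; rewrite scale0r mul0r.
rewrite (Lsum _ (fun k => ('C(n, k) * k ^_ j)%:R *: ('X^k * (C%:P - 'X) ^+ (n - k)))).
rewrite (_ : 'X + (C%:P - 'X) = C%:P); last by ring.
rewrite -polyC_exp mulrC mul_polyC !LZ => e.
have Cn : C ^+ n = C ^+ j * C ^+ (n - j) by rewrite -exprD subnKC.
apply: (mulfI (_ : C ^+ n != 0)); first by rewrite expf_neq0 ?gt_eqF.
rewrite mulr_sumr (eq_bigr (fun k : 'I_n.+1 => Lf (('C(n, k) * k ^_ j)%:R *: ('X^k * (C%:P - 'X) ^+ (n - k))))).
  by rewrite e Cn; field; rewrite gt_eqF// exprn_gt0.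
by move=> k _; rewrite /w LZ natrM; field; rewrite gt_eqF// exprn_gt0.
Qed.

Let w_sum n : \sum_(k < n.+1) w n k = 1.
Proof.
have := @w_ffact n 0 (leq0n n); rewrite !ffactn0 expr0 Lf1 mulr1 divr1 => h; rewrite -[RHS]h.
by apply: eq_bigr => k _; rewrite ffactn0 mulr1.
Qed.

Let m n j := \sum_(k < n.+1) w n k * (C * (k%:R / n%:R)) ^+ j.

Let m_bound n j : (j.+1.*2 <= n)%N -> `|m n j - Lf 'X^j| <= C ^+ j * (j.+1.*2 * j)%:R / n%:R.
Proof.
move=> jn; have jn' : (j <= n)%N by rewrite (leq_trans _ jn)// doubleS !leqW// -addnn leq_addr.
have fp : 0 < (n ^_ j)%:R :> R by rewrite ltr0n ffact_gt0.
have Cj : 0 < C ^+ j by rewrite exprn_gt0.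
have -> : Lf 'X^j = \sum_(k < n.+1) w n k * (C ^+ j * ((k ^_ j)%:R / (n ^_ j)%:R)).
  rewrite (eq_bigr (fun k : 'I_n.+1 => w n k * (k ^_ j)%:R * (C ^+ j / (n ^_ j)%:R))); last by move=> k _; ring.
  by rewrite -mulr_suml w_ffact//; field; rewrite !gt_eqF.
rewrite /m -sumrB; apply: le_trans (ler_norm_sum _ _ _) _.
rewrite -[leRHS]mul1r -[X in _ <= X * _](w_sum n) mulr_suml; apply: ler_sum => k _.
rewrite -mulrBr normrM (ger0_norm (w_ge0 n k)) ler_wpM2l// exprMn -mulrBr normrM (ger0_norm (ltW Cj)).
by rewrite -mulrA ler_pM2l// ffact_ratio_bound// -ltnS.
Qed.

Let m_cvg j : m n j @[n --> \oo] --> Lf 'X^j.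
Proof.
apply/cvgrPdist_le => e e0.
pose K := C ^+ j * (j.+1.*2 * j)%:R.
have K0 : 0 <= K by rewrite mulr_ge0 ?exprn_ge0 ?(ltW C0).
exists (maxn j.+1.*2 (Num.truncn (K / e)).+1) => // n /=; rewrite geq_max => /andP[jn kn].
rewrite distrC; apply: le_trans (m_bound jn) _.
have n0 : 0 < n%:R :> R by rewrite ltr0n (leq_trans _ jn)// double_gt0.
rewrite ler_pdivrMr// -ler_pdivrMl// mulrC ltW// (lt_le_trans (truncnS_gt _))//.
by rewrite ler_nat.
Qed.

Let F n k := \sum_(i < k.+1) w n i.

Let F_homo n : {homo F n : i j / (i <= j)%N >-> i <= j}.
Proof.
apply: homo_leq => // [x y z|k]; first exact: le_trans.
by rewrite /F [in leRHS]big_ord_recr/= lerDl.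
Qed.

Let F01 n k : (k <= n)%N -> 0 <= F n k <= 1.
Proof. by move=> kn; rewrite -(w_sum n) sumr_ge0//=; exact: (F_homo n kn). Qed.

Let cnt (n : nat) (u : R) := (\sum_(k < n) (F n k < u)%R)%N.
Let Q (n : nat) (u : R) : R := C * ((cnt n u)%:R / n%:R).

Let cnt_le n u : (cnt n u <= n)%N.
Proof.
rewrite -[leqRHS]card_ord -sum1_card; apply: leq_sum => k _.
by case: (_ < _).
Qed.

Let Q_bnd n u : 0 <= Q n u <= C.
Proof.
rewrite /Q mulr_ge0 ?divr_ge0 ?(ltW C0)//= ler_piMr ?(ltW C0)//.
case: n => [|n]; first by rewrite invr0 mulr0.
by rewrite ler_pdivrMr ?ltr0n// mul1r ler_nat.
Qed.

Let Q_nd n : nondecreasing_fun (Q n).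
Proof.
move=> u v uv; rewrite /Q ler_wpM2l ?(ltW C0)// ler_wpM2r ?invr_ge0// ler_nat.
apply: leq_sum => k _; case: (ltP (F n k) u) => // h.
by rewrite (lt_le_trans h uv).
Qed.

(** The point is that the bound does not depend on n: the j-th power of [Q n] is a sum of upward
    steps of total height at most C^j, and each step is handled by [riemann_sum_step]. *)
Let riemann_m n N j : (0 < n)%N -> (0 < N)%N ->
  `|N%:R^-1 * (\sum_(i < N) Q n (i.+1%:R / N%:R) ^+ j) - m n j| <= C ^+ j / N%:R.
Proof.
move=> n0 N0; pose G k := (C * (k%:R / n%:R)) ^+ j.
have Np : 0 < N%:R :> R by rewrite ltr0n.
have np : 0 < n%:R :> R by rewrite ltr0n.
have QG u : Q n u ^+ j = G 0 + \sum_(k < n) (G k.+1 - G k) * (F n k < u)%R%:R.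
  by rewrite (step_sum G u n (F_homo n)) addrC subrK.
have dG k : 0 <= G k.+1 - G k.
  rewrite subr_ge0 lerXn2r ?nnegrE ?mulr_ge0 ?divr_ge0 ?(ltW C0)//.
  by rewrite ler_pM2l// ler_pM2r ?invr_gt0// ler_nat.
have tG : \sum_(k < n) (G k.+1 - G k) = G n - G 0.
  by rewrite -(big_mkord xpredT (fun k => G k.+1 - G k)) telescope_sumr.
have mE : m n j = G 0 + \sum_(k < n) (G k.+1 - G k) * (1 - F n k).
  rewrite /m -/(G _) (abel_weights (w n) G) w_sum mul1r.
  under [in RHS]eq_bigr do rewrite mulrBr mulr1.
  by rewrite sumrB tG addrA [G 0 + _]addrC subrK.
have -> : N%:R^-1 * (\sum_(i < N) Q n (i.+1%:R / N%:R) ^+ j) = G 0 +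
    \sum_(k < n) (G k.+1 - G k) * (N%:R^-1 * \sum_(i < N) (F n k < i.+1%:R / N%:R)%R%:R).
  under eq_bigr do rewrite QG.
  rewrite big_split/= sumr_const card_ord -[G 0 *+ N]mulr_natl mulrDr mulrA mulVf ?gt_eqF// mul1r.
  congr (_ + _); rewrite exchange_big/= mulr_sumr; apply: eq_bigr => k _.
  by rewrite -mulr_sumr mulrCA.
rewrite mE opprD addrACA subrr add0r -sumrB; apply: le_trans (ler_norm_sum _ _ _) _.
apply: (@le_trans _ _ (\sum_(k < n) (G k.+1 - G k) * N%:R^-1)).
  apply: ler_sum => k _; rewrite -mulrBr normrM (ger0_norm (dG k)) ler_wpM2l// distrC.
  by apply: riemann_sum_step => //; apply: F01; rewrite ltnW.
rewrite -mulr_suml tG ler_pM2r ?invr_gt0//.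
have -> : G n = C ^+ j by rewrite /G divff ?gt_eqF// mulr1.
by rewrite lerBlDr lerDl exprn_ge0// mulr_ge0 ?(ltW C0).
Qed.

(* The Bernstein weights [w n] are the masses of discrete measures on [[0, C]] whose moments
   tend to those of [Lf].  [Q n] is the quantile function of the n-th one; an ultrafilter limit of
   the [Q n] is monotone, hence uniformly approximated in mean by Riemann sums, which allows
   exchanging the limit with the integral. *)
Lemma hausdorff_moment : exists q : R -> R, [/\ nondecreasing_fun q,
  forall u, 0 <= q u <= C & forall j, \int[mu]_(u in `[0, 1]) q u ^+ j = Lf 'X^j].
Proof.
have [U [UU subU]] := ultraFilterLemma (@eventually_filter : ProperFilter \oo).
have PU : ProperFilter U := @ultra_proper _ _ UU.
have /choice[q qP] : forall u, exists l, (Q n u @[n --> U] --> l) /\ 0 <= l <= C.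
  move=> u; have [|l [lC lcl]] := @segment_compact R 0 C (Q n u @[n --> U]) _.
    by rewrite /= near_simpl; apply: nearW => n; rewrite /= in_itv/=.
  exists l; split; last by move: lC; rewrite /= in_itv.
  (* For an ultrafilter a cluster point is a limit: otherwise the complement of a neighbourhood
     would have its preimage in [U]. *)
  move=> A Al; have [//|UnA] := in_ultra_setVsetC (Q ^~ u @^-1` A) UU.
  by have [x [nAx Ax]] := lcl (~` A) A UnA Al; case: nAx.
have q_nd : nondecreasing_fun q.
  move=> u v uv; apply: (ler_cvg_to (qP u).1 (qP v).1).
  by apply: nearW => n; exact: Q_nd.
exists q; split => // [u|j]; first exact: (qP u).2.
have qj_nd : nondecreasing_fun (fun u => q u ^+ j).
  move=> u v uv; have /andP[u0 _] := (qP u).2; have /andP[v0 _] := (qP v).2.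
  by rewrite lerXn2r ?nnegrE//; exact: q_nd.
apply/eqP; rewrite -subr_eq0 -normr_le0; apply/ler_addgt0Pl => e e0; rewrite addr0.
(* Two errors of size C^j / N are to sum to at most e: replacing the integral of q^j by a Riemann
   sum, and replacing that sum by the moment of the functional. *)
pose N := (Num.truncn (2 * C ^+ j / e)).+1.
have Np : 0 < N%:R :> R by rewrite ltr0n.
have b1 := riemann_sum_monotone qj_nd (ltn0Sn _ : (0 < N)%N).
set S := N%:R^-1 * _ in b1.
have b2 : `|S - Lf 'X^j| <= C ^+ j / N%:R.
  have cS : (N%:R^-1 * (\sum_(i < N) Q n (i.+1%:R / N%:R) ^+ j) - m n j) @[n --> U] --> S - Lf 'X^j.
    apply: cvgB; last exact: cvg_trans (cvg_fmap2 subU) (@m_cvg j).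
    apply: cvgMr; apply: cvg_big => [|i _]; first exact: add_continuous.
    exact: (continuous_cvg _ (@exprn_continuous _ j _) (qP _).1).
  apply: (cvgr_to_le (cvg_norm cS)).
  by apply: subU; exists 1%N => // n /= n0; exact: riemann_m.
have b3 : (q 1 ^+ j - q 0 ^+ j) / N%:R <= C ^+ j / N%:R.
  rewrite ler_pM2r ?invr_gt0//; have /andP[u0 _] := (qP 0).2; have /andP[v0 v1] := (qP 1).2.
  rewrite lerBlDr; apply: (@le_trans _ _ (C ^+ j)); first by rewrite lerXn2r ?nnegrE ?(ltW C0).
  by rewrite lerDl exprn_ge0.
rewrite -(subrKA S) (le_trans (ler_normD _ _))//.
apply: (@le_trans _ _ (C ^+ j / N%:R + C ^+ j / N%:R)); first by apply: lerD => //; exact: le_trans b1 b3.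
have := truncnS_gt (2 * C ^+ j / e); rewrite -/N ltr_pdivrMr// => h.
by rewrite -mulrDl ler_pdivrMr//; move: h; lra.
Qed.

End Hausdorff.
End HausdorffMoment.

(** * The representing measure and orthogonality *)

Section MomentMeasure.
Variable R : realType.

Lemma measurable_horner (p : {poly R}) : measurable_fun [set: R] (fun x : R => p.[x]).
Proof.
rewrite (_ : (fun x => p.[x]) = (fun x => \sum_(i < size p) p`_i * x ^+ i)).
  apply: measurable_sum => i; apply: measurable_funM; first exact: measurable_cst.
  exact: exprn_measurable.
by apply/funext => x; rewrite horner_coef.
Qed.

(** The monotone function of [hausdorff_moment] acts as a quantile function: the measure is the
    image under it of the uniform law on [0, 1]. *)
Lemma moment_measure (Lf : {poly R} -> R) (C : R) :
  (forall p q, Lf (p + q) = Lf p + Lf q) -> (forall c p, Lf (c *: p) = c * Lf p) ->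
  Lf 1 = 1 -> 0 < C -> (forall k l, 0 <= Lf ('X^k * (C%:P - 'X) ^+ l)) ->
  exists nu : {measure set R -> \bar R}, nu [set x : R | x < 0] = 0%E /\
    forall p : {poly R}, nu.-integrable setT (fun x => p.[x]%:E) /\
      (\int[nu]_x p.[x]%:E = (Lf p)%:E)%E.
Proof.
move=> LD LZ Lf1 C0 Lpos.
have [q [q_nd qC qL]] := hausdorff_moment LD LZ Lf1 C0 Lpos.
have mq : measurable_fun [set: measurableTypeR R] (q : measurableTypeR R -> R) := nondecreasing_measurable measurableT q_nd.
pose U := uniform_prob (@ltr01 R).
have mono j : U.-integrable setT (EFin \o (fun u => q u ^+ j)) /\ \int[U]_u (q u ^+ j) = Lf 'X^j.
  have mqj : measurable_fun [set: R] (fun u => q u ^+ j) by exact: measurable_funX.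
  split.
    apply: measurable_bounded_integrable => //.
      by rewrite [X in (X < _)%E](@probability_setT _ _ _ U) ltry.
    exists (C ^+ j); split; first exact: num_real.
    move=> M hM u _; have /andP[q0 q1] := qC u.
    by rewrite /= ger0_norm ?exprn_ge0// (le_trans _ (ltW hM))// lerXn2r ?nnegrE ?(ltW C0).
  rewrite -qL /Rintegral integral_uniform ?subr0 ?invr1 ?mul1e//.
    exact/measurable_EFinP.
  by move=> u; rewrite lee_fin exprn_ge0//; case/andP: (qC u).
have poly (p : {poly R}) : U.-integrable setT (EFin \o (fun u => p.[q u])) /\ \int[U]_u p.[q u] = Lf p.
  suff H n (c : nat -> R) : U.-integrable setT (EFin \o (fun u => (\sum_(i < n) c i *: 'X^i).[q u])) /\
      \int[U]_u (\sum_(i < n) c i *: 'X^i).[q u] = Lf (\sum_(i < n) c i *: 'X^i).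
    by rewrite (poly_expand p); exact: (H _ (fun i => p`_i)).
  elim: n => [|n [ih1 ih2]].
    have e : EFin \o (fun u => (\sum_(i < 0) c i *: 'X^i).[q u]) = (fun=> 0%E).
      by apply/funext => u /=; rewrite big_ord0 horner0.
    rewrite e; split; first exact: integrable0.
    rewrite [X in Lf X]big_ord0 /Rintegral; have := LZ 0 0; rewrite scale0r mul0r => ->.
    by rewrite (eq_integral (fun=> 0%E)) ?integral0// => u _; rewrite big_ord0 horner0.
  have [i1 i2] := mono n.
  have i3 : U.-integrable setT (EFin \o (fun u => c n * q u ^+ n)) := integrableZl measurableT (c n) i1.
  have e u : (\sum_(i < n.+1) c i *: 'X^i).[q u] = (\sum_(i < n) c i *: 'X^i).[q u] + c n * q u ^+ n.
    by rewrite big_ord_recr/= hornerD hornerZ hornerXn.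
  split.
    rewrite (_ : EFin \o _ = EFin \o (fun u => (\sum_(i < n) c i *: 'X^i).[q u] + c n * q u ^+ n)).
      exact: (integrableD measurableT ih1 i3).
    by apply/funext => u /=; rewrite e.
  rewrite (@eq_Rintegral _ _ _ U _ (fun u => (\sum_(i < n) c i *: 'X^i).[q u] + c n * q u ^+ n)); last by move=> u _; rewrite e.
  by rewrite RintegralD// RintegralZl// ih2 i2 big_ord_recr/= LD LZ.
pose nu : {measure set R -> \bar R} := measure_function_pushforward__canonical__measure_function_Measure U mq.
exists nu; split.
  rewrite /nu/= /pushforward (_ : _ @^-1` _ = set0) ?measure0//.
  apply/seteqP; split => // u /=; rewrite ltNge.
  by case/andP: (qC u) => ->.
move=> p; have [i1 i2] := poly p.
have mp : measurable_fun [set: R] (fun x : R => p.[x]%:E) by apply/measurable_EFinP; exact: measurable_horner.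
have i3 : U.-integrable (q @^-1` setT) ((fun x : R => p.[x]%:E) \o q) by exact: i1.
split; first exact: (integrable_pushforward mq mp i3 measurableT).
apply: (etrans (integral_pushforward mq mp i3 measurableT)); rewrite -i2 /Rintegral fineK//.
exact: (integrable_fin_num measurableT i1).
Qed.

(** [Prec al be k] is a nonzero multiple of [shoot a b k], so [momentfun_shoot] gives orthogonality.
    The two bounds by [c] make the Jacobi operator bounded, with [4 * c] as right end of the
    interval. *)
Lemma orthogonal_Rplus_Prec (a b al be : nat -> R) (c : R) :
  (forall i, 0 < a i) -> (forall i, 0 < b i) ->
  (forall i, al i.+1 ^+ 2 = a i) -> (forall i, (be i.+1 ^+ 2)^-1 = b i) ->
  (forall k, b k <= c * a k) -> (forall k, b k <= c * a k.+1) ->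
  exists nu : {measure set R -> \bar R}, orthogonal_Rplus nu (Prec al be).
Proof.
move=> a0 b0 alE beE bc1 bc2.
have c0 : 0 < c by have := lt_le_trans (b0 0) (bc1 0); rewrite pmulr_lgt0.
have C0 : 0 < 4 * c by rewrite mulr_gt0.
have Lpos k l := momentfun_bernstein_ge0 a0 b0 k l C0 (fun p => momentfunX_sqr_le a0 b0 p bc1 bc2).
have [nu [nu0 nuP]] := moment_measure (linextD _) (linextZ _) (momentfun1 a0 b0) C0 Lpos.
pose K k : R := \prod_(i < k) - (b i / a i).
have K0 k : K k != 0.
  by apply/prodf_neq0 => i _; rewrite oppr_eq0 mulf_neq0 ?invr_eq0 ?gt_eqF.
have PE j k x : (Prec al be j).[x] * (Prec al be k).[x] =
    ((K j * K k) *: (shoot a b j * shoot a b k)).[x].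
  by rewrite !(horner_Prec a0 b0 _ _ alE beE) hornerZ hornerM -!/(K _) mulrACA.
have PP j k := nuP ((K j * K k) *: (shoot a b j * shoot a b k)).
have LE j k : linext (stringmoment a b) ((K j * K k) *: (shoot a b j * shoot a b k)) = K j * K k * ((j == k)%:R * (a 0 / a k)).
  by rewrite linextZ -/(momentfun a b _) (momentfun_shoot a0 b0).
exists nu; split => //.
- move=> k; have [h _] := PP k k.
  by rewrite (_ : (fun x => _) = (fun x => ((K k * K k) *: (shoot a b k * shoot a b k)).[x]%:E))//;
    apply/funext => x; rewrite expr2 PE.
- move=> j k jk; under eq_integral do rewrite PE.
  by have [_ ->] := PP j k; rewrite LE (introF eqP jk) mul0r mulr0.
- move=> k; under eq_integral do rewrite expr2 PE.
  have [_ ->] := PP k k; rewrite LE eqxx mul1r lte_fin mulr_gt0 ?divr_gt0//.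
  by rewrite -expr2 exprn_even_gt0//= K0.
Qed.

End MomentMeasure.

(** * Boundedness of the two Jacobi operators *)

Section Orthogonality.
Variables (R : realType) (lam : R).
Hypothesis hlam : - 2^-1 < lam.

Let twolam : 0 < 1 + 2 * lam.
Proof. by rewrite -ltrBlDl sub0r (_ : -1 = 2 * - 2^-1) ?ltr_pM2l//; field. Qed.

(** The second summand compensates the factor n + 1 + 2 lam in [hsq_le_next], which for n = 0 tends
    to 0 as lam approaches -1/2. The 8 absorbs the crude lower bounds by 1/2 in [natr_bounds]. *)
Let bound := 8 + 8 / (1 + 2 * lam).

Let bound_ge8 : 8 <= bound.
Proof. by rewrite lerDl divr_ge0 ?(ltW twolam). Qed.

Let natr_bounds n : [/\ 2^-1 <= n.+1%:R + lam, n.+1%:R + 2 * lam <= 2 * (n.+1%:R + lam),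
  1 + 2 * lam <= n.+1%:R + 2 * lam & n.+2%:R <= 2 * (n.+2%:R + lam)].
Proof.
have n0 := ler0n R n; rewrite -[n.+2%:R]natr1 -[n.+1%:R]natr1.
by split; move: n0 twolam; lra.
Qed.

Let hsq_le_prev n : hsq lam n.+1 <= bound * phi2 lam n.
Proof.
case: n => [|n].
  have [l1 _ _ _] := natr_bounds 0; have h0 := ltW (hsq_gt0 hlam 0).
  rewrite /phi2 -(hsq1 hlam).
  have -> : bound * ((1 + lam) * hsq lam 1 / 2) = bound * (1 + lam) / 2 * hsq lam 1 by ring.
  rewrite ler_peMl//.
  have : 8 * 2^-1 <= bound * (1 + lam) by apply: ler_pM.
  by lra.
have [x1 zx _ _] := natr_bounds n; have [y1 _ _ _] := natr_bounds n.+1.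
have x0 : 0 < n.+1%:R + lam by exact: natrS_lam_gt0.
have y0 : 0 < n.+2%:R + lam by exact: natrS_lam_gt0.
have N2 : 2 <= n.+2%:R :> R by rewrite ler_nat.
rewrite (hsqSE hlam) /phi2 ler_pdivrMr ?mulr_gt0//; have h0 := hsq_gt0 hlam n.
move: (n.+2%:R) (n.+1%:R + lam) (n.+1%:R + 2 * lam) (n.+2%:R + lam) x1 zx y1 x0 y0 N2 => N x z y x1 zx y1 x0 y0 N2.
rewrite [_ * z]mulrC -mulrA (_ : bound * _ * _ = bound * x * (N * y) * (x * hsq lam n.+1)); last by ring.
rewrite (ler_pM2r (mulr_gt0 x0 h0)) (le_trans zx)//.
have Ny : 2 * 2^-1 <= N * y by apply: ler_pM.
rewrite divff// in Ny.
rewrite (@le_trans _ _ (bound * x))//; first by rewrite ler_pM2r// (le_trans _ bound_ge8)// ler_nat.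
by rewrite ler_peMr// mulr_ge0 ?(ltW x0)// (le_trans _ bound_ge8).
Qed.

Let hsq_le_next n : hsq lam n.+1 <= bound * phi2 lam n.+2.
Proof.
have [x1 _ zl yN] := natr_bounds n.
have y0 : 0 < n.+2%:R + lam by exact: natrS_lam_gt0.
have N0 : 0 < n.+2%:R :> R by rewrite ltr0n.
have bz : 8 <= bound * (n.+1%:R + 2 * lam).
  apply: (@le_trans _ _ (bound * (1 + 2 * lam))); last first.
    by rewrite ler_wpM2l// (le_trans _ bound_ge8).
  by rewrite /bound mulrDl divfK ?gt_eqF// lerDr mulr_ge0 ?(ltW twolam).
rewrite /= (hsqSE hlam) -[leLHS]mul1r.
move: (n.+2%:R) (n.+1%:R + lam) (n.+1%:R + 2 * lam) (n.+2%:R + lam) x1 zl yN y0 N0 bz => N x z y x1 zl yN y0 N0 bz.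
have -> : bound * (y ^+ 2 * (x * z * hsq lam n.+1 / (N * y))) = bound * z * x * y / N * hsq lam n.+1.
  by field; rewrite !gt_eqF.
rewrite ler_pM2r ?hsq_gt0// ler_pdivlMr// mul1r (le_trans yN)// ler_pM2r//.
have : 8 * 2^-1 <= bound * z * x by apply: ler_pM.
by lra.
Qed.

Lemma P_orthogonal : exists nu : {measure set R -> \bar R}, orthogonal_Rplus nu (P lam).
Proof.
apply: (@orthogonal_Rplus_Prec _ (fun i => phi2 lam i.*2.+1) (fun i => hsq lam i.*2.+2) _ _ bound) => *.
- exact: phi2_gt0.
- exact: hsq_gt0.
- exact: alpha_sqr.
- exact: beta_sqrV.
- exact: hsq_le_prev.
- exact: hsq_le_next.
Qed.

Lemma Pt_orthogonal : exists nu : {measure set R -> \bar R}, orthogonal_Rplus nu (Pt lam).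
Proof.
apply: (@orthogonal_Rplus_Prec _ (fun i => phi2 lam i.*2) (fun i => hsq lam i.*2.+1) _ _ bound) => *.
- exact: phi2_gt0.
- exact: hsq_gt0.
- exact: alphat_sqr.
- exact: betat_sqrV.
- exact: hsq_le_prev.
- exact: hsq_le_next.
Qed.

End Orthogonality.

Theorem theorem2p3 (R : realType) (lam : R) (hlam : - 2^-1 < lam) :
  (exists mu : {measure set R -> \bar R}, orthogonal_Rplus mu (P lam)) /\
  (exists mu : {measure set R -> \bar R}, orthogonal_Rplus mu (Pt lam)) /\
  (forall m : nat, (1 <= m)%N ->
     (exists mu1 : R, smallest_root (P lam m) mu1 /\
        markov_const (m.*2) lam = 2 / Num.sqrt mu1) /\
     (exists mu1t : R, smallest_root (Pt lam m) mu1t /\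
        markov_const (m.*2).-1 lam = 2 / Num.sqrt mu1t)).
Proof.
split; first exact: P_orthogonal.
split; first exact: Pt_orthogonal.
case=> // m _; split; first exact: markov_even.
by rewrite doubleS; exact: markov_odd.
Qed.
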